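(* Consider types A1 and A2 in infinite dimension (see context), let $\sigma:\mathbb{N}^*\to(A,\prec)$ be a bijection onto a totally ordered set and let $\mathbf{X}=\mathbf{X}(\mathcal{F}_\sigma,E)$. Let $\mathfrak{I}^\epsilon_\infty(\iota)=\mathfrak{I}_\infty(\iota)$ in type A1 and $\mathfrak{I}^\epsilon_\infty(\iota)=\mathfrak{I}'_\infty(\iota)$ in type A2. (a) For every $w\in\mathfrak{I}^\epsilon_\infty(\iota)$, $$\boldsymbol{\mathcal{O}}_w\cap\boldsymbol{\mathfrak{O}}_w=\{\mathcal{F}_\sigma(\underline v):\underline v\text{ is }w\text{-dual and }w\text{-conjugate}\}\ne\emptyset.$$ (b) For every $w\in\mathfrak{I}^\epsilon_\infty(\iota)$, $$\boldsymbol{\mathcal{O}}_w=\{\mathcal{F}\in\mathbf{X}:(\mathcal{F}^\perp,\mathcal{F})\in\mathbb{O}^\perp_{w\iota}\}\quad\text{and}\quad\boldsymbol{\mathfrak{O}}_w=\{\mathcal{F}\in\mathbf{X}:(\gamma(\mathcal{F}),\mathcal{F})\in\mathbb{O}^\gamma_{w\iota}\}.$$ (c) The subsets $\boldsymbol{\mathcal{O}}_w$ (for $w\in\mathfrak{I}^\epsilon_\infty(\iota)$) are exactly the $\mathbf{K}$-orbits of $\mathbf{X}$. The subsets $\boldsymbol{\mathfrak{O}}_w$ (for $w\in\mathfrak{I}^\epsilon_\infty(\iota)$) are exactly the $\mathbf{G}^0$-orbits of $\mathbf{X}$. Moreover $\boldsymbol{\mathcal{O}}_w\cap\boldsymbol{\mathfrak{O}}_w$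 is a single $\mathbf{K}\cap\mathbf{G}^0$-orbit.
   Context: $\mathbb{N}^*$ is the set of positive integers; $\mathbf{V}$ is a complex vector space with basis $E=(e_1,e_2,\ldots)$; vectors are identified with coordinate columns, $\overline{x}$ is the coordinatewise conjugate. $\mathbf{G}(E)=\{g\in\mathrm{Aut}(\mathbf{V}):g(e_\ell)=e_\ell\text{ for all but finitely many }\ell\}$. $\Omega$ is a block-diagonal $\mathbb{N}^*\times\mathbb{N}^*$-matrix whose diagonal blocks are each $\begin{pmatrix}0&1\\1&0\end{pmatrix}$ or $(1)$ in type A1 and all $\begin{pmatrix}0&1\\-1&0\end{pmatrix}$ in type A2. $\omega(x,y)={}^tx\,\Omega\,y$, $\gamma(x)=\Omega\overline{x}$, $\mathbf{K}=\{g\in\mathbf{G}(E):\omega(gx,gy)=\omega(x,y)\ \forall x,y\}$, $\mathbf{G}^0=\{g\in\mathbf{G}(E):\gamma g=g\gamma\}$. $\iota:\mathbb{N}^*\to\mathbb{N}^*$, $\ell\mapsto\ell^*$, where $\ell^*$ is the unique index with $\omega(e_\ell,e_{\ell^*})\ne0$. $\mathfrak{S}_\infty$ is the group of permutations of $\mathbb{N}^*$ fixing all but finitely many elements. $\mathfrak{I}_\infty(\iota)$ is the set of maps $w:\mathbb{N}^*\to\mathbb{N}^*$ with $w^2=\mathrm{id}$ and $w(\ell)=\ell^*$ for all but finitely many $\ell$ (so $w\iota\in\mathfrak{S}_\infty$); $\mathfrak{I}'_\infty(\iota)$ is the subset of those without fixed points. Write $w_k=w(k)$. For a bijection $\tau:\mathbb{N}^*\to(B,\prec)$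 onto a totally ordered set and a basis $\underline v=(v_1,v_2,\ldots)$ of $\mathbf{V}$, $\mathcal{F}_\tau(\underline v)=\{F'_b,F''_b:b\in B\}$ with $F'_b=\langle v_\ell:\tau(\ell)\prec b\rangle_{\mathbb C}$, $F''_b=\langle v_\ell:\tau(\ell)\preceq b\rangle_{\mathbb C}$; $\mathcal{F}_\tau=\mathcal{F}_\tau(E)$. $\mathbf{X}(\mathcal{F}_\tau,E)$ denotes the $\mathbf{G}(E)$-orbit of $\mathcal{F}_\tau$, i.e. the set of $\mathcal{F}_\tau(\underline v)$ with $v_\ell=e_\ell$ for all but finitely many $\ell$. For bijections $\tau,\sigma$ onto totally ordered sets and $u\in\mathfrak{S}_\infty$, $(\mathbb{O}_{\tau,\sigma})_u=\{(g\mathcal{F}_\tau,g\mathcal{F}_{\sigma u}):g\in\mathbf{G}(E)\}\subset\mathbf{X}(\mathcal{F}_\tau,E)\times\mathbf{X}(\mathcal{F}_\sigma,E)$. $(A^*,\prec^* )$ is $A$ with the reversed order and $\sigma^\perp:\mathbb{N}^*\to A^*$, $\sigma^\perp(\ell)=\sigma(\ell^* )$. Put $\mathbb{O}^\perp_u=(\mathbb{O}_{\sigma^\perp,\sigma})_u$ and $\mathbb{O}^\gamma_u=(\mathbb{O}_{\sigma\circ\iota,\sigma})_u$. For $\mathcal{F}\in\mathbf{X}$, $\mathcal{F}^\perp=\{F^\perp:F\in\mathcal{F}\}\in\mathbf{X}(\mathcal{F}_{\sigma^\perp},E)$ ($\perp$ for $\omega$) and $\gamma(\mathcal{F})=\{\gamma(F):F\in\mathcal{F}\}\in\mathbf{X}(\mathcal{F}_{\sigma\circ\iota},E)$.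 For $w\in\mathfrak{I}_\infty(\iota)$, consider bases $\underline v=(v_1,v_2,\ldots)$ of $\mathbf{V}$ with $v_\ell=e_\ell$ for all but finitely many $\ell$. Such $\underline v$ is $w$-dual if for all $k,\ell$: $\omega(v_\ell,v_k)=0$ when $\ell\ne w_k$ and $\omega(v_\ell,v_k)\in\{1,-1\}$ when $\ell=w_k$. It is $w$-conjugate if $\gamma(v_k)\in\{v_{w_k},-v_{w_k}\}$ for all $k$. Set $\boldsymbol{\mathcal{O}}_w=\{\mathcal{F}_\sigma(\underline v):\underline v\ w\text{-dual}\}$, $\boldsymbol{\mathfrak{O}}_w=\{\mathcal{F}_\sigma(\underline v):\underline v\ w\text{-conjugate}\}$. *)

(* Defs.v *)
(* Positive integers are encoded by [nat] with a shift by one: the index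
   l >= 1 is represented by l - 1. *)
From mathcomp Require Export all_boot all_order all_algebra.
From mathcomp Require Export boolp classical_sets functions cardinality fsbigop.
From mathcomp Require Export reals complex.

Set Implicit Arguments.
Unset Strict Implicit.
Unset Printing Implicit Defensive.

Import Order.TTheory GRing.Theory Num.Theory.

Global Open Scope classical_set_scope.
Global Open Scope complex_scope.
Global Open Scope ring_scope.

Definition almost_all (P : nat -> Prop) : Prop := finite_set [set l | ~ P l].

Inductive typeA := A1 | A2.

Section BlockDiagonal.
Variable C : pzRingType.

Definition block2 (t : typeA) : 'M[C]_2 :=
  \matrix_(i, j) (if i == j then 0
                  else if t is A2 then (if (i < j)%N then 1 else -1) else 1).

(* The size of a diagonal block is coded by a boolean: [true] for a 2 x 2
   block, [false] for the 1 x 1 block (1); thus the size is [b.+1]. *)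
Definition diag_block (t : typeA) (b : bool) : 'M[C]_b.+1 :=
  if b return 'M[C]_b.+1 then block2 t else 1%:M.

Definition block_start (s : nat -> bool) (n : nat) : nat :=
  (\sum_(i < n) (s i).+1)%N.

Definition is_Omega (t : typeA) (Om : nat -> nat -> C) : Prop :=
  exists s : nat -> bool,
    [/\ t = A2 -> forall n, s n,
        forall (n : nat) (i j : 'I_(s n).+1),
          Om (block_start s n + i)%N (block_start s n + j)%N
            = diag_block t (s n) i j
      & forall k l : nat, Om k l != 0 ->
          exists n, (block_start s n <= k < block_start s n.+1)%N /\
                    (block_start s n <= l < block_start s n.+1)%N].

End BlockDiagonal.

Section VectorSpace.
Variables (R : realType) (V : lmodType R[i]).

(* [c] is the finitely supported family of coordinates of [x] in [v]; the
   explicit finiteness is needed as [\sum_(l \in _)] is 0 on infinite supports. *)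
Definition is_coord (v : nat -> V) (x : V) (c : nat -> R[i]) : Prop :=
  finite_set [set l | c l != 0] /\ x = \sum_(l \in [set: nat]) c l *: v l.

Definition is_basis (v : nat -> V) : Prop :=
  forall x : V, exists! c : nat -> R[i], is_coord v x c.

Definition coord (v : nat -> V) (x : V) : nat -> R[i] :=
  xget (fun=> 0) [set c | is_coord v x c].

Definition span (S : set V) : set V :=
  smallest [set U : set V | GRing.submod_closed [in U]] S.

Definition flag (d : Order.disp_t) (B : orderType d) (tau : nat -> B)
    (v : nat -> V) : set (set V) :=
  [set F | exists b : B,
     F = span (v @` [set l | (tau l < b)%O]) \/
     F = span (v @` [set l | (tau l <= b)%O])].

Definition act (g : V -> V) (F : set (set V)) : set (set V) :=
  [set g @` U | U in F].

Definition orbit (H : set {linear V -> V}) (F : set (set V)) :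
    set (set (set V)) :=
  [set act g F | g in H].

Variables (e : nat -> V) (Om : nat -> nat -> R[i]).

Definition G : set {linear V -> V} :=
  [set g : {linear V -> V} | bijective g /\ almost_all (fun l => g (e l) = e l)].

Definition omega (x y : V) : R[i] :=
  \sum_(k \in [set: nat]) \sum_(l \in [set: nat])
    coord e x k * Om k l * coord e y l.

Definition gamma (x : V) : V :=
  \sum_(k \in [set: nat])
    (\sum_(l \in [set: nat]) Om k l * (coord e x l)^*%C) *: e k.

Definition K : set {linear V -> V} :=
  [set g : {linear V -> V} | G g /\ forall x y, omega (g x) (g y) = omega x y].

Definition G0 : set {linear V -> V} :=
  [set g : {linear V -> V} | G g /\ forall x, gamma (g x) = g (gamma x)].

Definition iota_star (l : nat) : nat :=
  xget 0%N [set m | omega (e l) (e m) != 0].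

Definition I_inf : set (nat -> nat) :=
  [set w : nat -> nat | involutive w /\ almost_all (fun l => w l = iota_star l)].

Definition I'_inf : set (nat -> nat) :=
  [set w : nat -> nat | I_inf w /\ forall l, w l <> l].

Definition I_eps (t : typeA) : set (nat -> nat) :=
  if t is A1 then I_inf else I'_inf.

Definition X (d : Order.disp_t) (B : orderType d) (tau : nat -> B) :
    set (set (set V)) :=
  orbit G (flag tau e).

Definition OO (d1 d2 : Order.disp_t) (B1 : orderType d1) (B2 : orderType d2)
    (tau : nat -> B1) (sigma : nat -> B2) (u : nat -> nat) :
    set (set (set V) * set (set V)) :=
  [set (act g (flag tau e), act g (flag (sigma \o u) e))
     | g in G].

Definition perp (F : set V) : set V :=
  [set x | forall y, F y -> omega x y = 0].

Definition flag_perp (F : set (set V)) : set (set V) := [set perp U | U in F].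

Definition flag_gamma (F : set (set V)) : set (set V) :=
  [set gamma @` U | U in F].

Definition E_basis (v : nat -> V) : Prop :=
  is_basis v /\ almost_all (fun l => v l = e l).

Definition dual_basis (w : nat -> nat) (v : nat -> V) : Prop :=
  E_basis v /\
  forall k l, (l <> w k -> omega (v l) (v k) = 0) /\
              (l = w k -> omega (v l) (v k) = 1 \/ omega (v l) (v k) = -1).

Definition conjugate_basis (w : nat -> nat) (v : nat -> V) : Prop :=
  E_basis v /\
  forall k, gamma (v k) = v (w k) \/ gamma (v k) = - v (w k).

Variables (d : Order.disp_t) (A : orderType d) (sigma : nat -> A).

Definition sigma_perp : nat -> A^d := fun l => sigma (iota_star l).

Definition OO_perp (u : nat -> nat) : set (set (set V) * set (set V)) :=
  OO sigma_perp sigma u.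

Definition OO_gamma (u : nat -> nat) : set (set (set V) * set (set V)) :=
  OO (sigma \o iota_star) sigma u.

Definition O_dual (w : nat -> nat) : set (set (set V)) :=
  [set flag sigma v | v in [set v | dual_basis w v]].

Definition O_conj (w : nat -> nat) : set (set (set V)) :=
  [set flag sigma v | v in [set v | conjugate_basis w v]].

End VectorSpace.

(* Main.v *)
Require Import Defs.
From mathcomp Require Import fingroup perm zify ring.
From HB Require Import structures.
Import Order.TTheory GRing.Theory Num.Theory.

Set Implicit Arguments.
Unset Strict Implicit.
Unset Printing Implicit Defensive.

(** Choose [n] so large that the bases and the involution [w] under consideration
    are standard beyond [n] and that the first [n] indices form a union of blocks.
    A basis is then given by an invertible matrix [P], and changing it without
    changing its flag means multiplying [P] on the right by a matrix that is
    triangular for the order of [sigma]. The basis is [w]-dual when [P^T Om P], and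
    [w]-conjugate when [P^-1 Om P^*] (entrywise conjugate), is monomial with
    underlying permutation [w] and entries [1] and [-1].

    Every flag has a [w]-dual basis for some [w]: the matrix [P^T Om P] is symmetric
    or antisymmetric, and triangular row and column operations make it monomial
    ([hermitian_monomial]). Every flag has a [w]-conjugate basis for some [w]: send
    [j] to the least leading index of [gamma x] over the vectors [x] with leading
    index [j] ([conjugation_monomial]).

    If a flag has a dual basis and a conjugate basis for the same [w], take an
    orthonormal basis of it for the positive definite form [omega (gamma x) y].
    The two conditions then bear on one unitary matrix, and a unitary matrix in the
    corresponding two double cosets of [w] is monomial ([unitary_is_monomial]); so,
    up to phases, the orthonormal basis is both dual and conjugate. Such bases exist
    for every [w] ([exists_signed_unitary]).

    For an adapted basis [v], the transform of the flag of [v] by [perp] or [gamma]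
    is the flag of [v \o w], with the reversed order for [perp]. The relative
    position of a flag and its transform determines [w] ([relative_position]): two
    bases that agree almost everywhere have a transition matrix with a nonvanishing
    transversal ([basis_matching]), and a permutation that moves finitely many
    indices and never increases them is the identity. Together with the existence of
    adapted bases this characterizes the sets of the statement by relative position.

    Finally, two bases adapted to the same [w] differ, up to signs, by an element of
    the group. Rescaling by a square root of the signs along [w] ([rescale]) makes
    this element preserve [omega] or commute with [gamma], and both at once if the
    bases are dual and conjugate, since positivity then forces the two families of
    signs to agree. *)

(** * Coordinates in an infinite basis *)

Lemma almost_allP (P : nat -> Prop) :
  almost_all P <-> exists N, forall l, (N <= l)%N -> P l.
Proof.
split=> [/finite_seqP[s Ps]|[N NP]].
  exists (\max_(l <- s) l).+1 => l lN; apply: contrapT => nP.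
  have ls : l \in s by have : [set l | ~ P l] l by []; rewrite Ps.
  by move: lN; rewrite ltnNge (@leq_bigmax_seq _ s xpredT (fun x => x)).
apply: (sub_finite_set _ (finite_II N)) => l /= nP.
by rewrite ltnNge; apply/negP => /NP.
Qed.

Section Coordinates.
Variables (R : realType) (V : lmodType R[i]).
Implicit Types (v u : nat -> V) (x y : V).

Lemma fsum_ord (M : nmodType) (f : nat -> M) N :
  (forall l, (N <= l)%N -> f l = 0) ->
  \sum_(l \in [set: nat]) f l = \sum_(l < N) f l.
Proof.
move=> f0; rewrite fsbig_ord; apply/esym/fsbig_widen => // l [_ /= /negP].
by rewrite -leqNgt; exact: f0.
Qed.

Lemma is_coordP v x c : is_coord v x c <->
  exists2 N, (forall l, (N <= l)%N -> c l = 0) & x = \sum_(l < N) c l *: v l.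
Proof.
split=> [[fc ->]|[N c0 ->]].
  have /almost_allP[N c0] : almost_all (fun l => c l = 0).
    by apply: sub_finite_set fc => l /= /eqP.
  by exists N => //; apply: fsum_ord => l /c0 ->; rewrite scale0r.
split; last by apply/esym/fsum_ord => l /c0 ->; rewrite scale0r.
apply: (@sub_finite_set _ _ [set l | ~ c l = 0]) => [l /= /eqP //|].
by apply/almost_allP; exists N.
Qed.

Section Basis.
Variables (v : nat -> V) (bv : is_basis v).

Lemma coordP x : is_coord v x (coord v x).
Proof.
have [c [cx _]] := bv x.
exact: (@xgetI _ (fun=> 0) [set c | is_coord v x c] _ cx).
Qed.

Lemma coord_unique x c : is_coord v x c -> coord v x = c.
Proof.
move=> cx; have [c' [_ u]] := bv x.
by rewrite -(u _ (coordP x)) -(u _ cx).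
Qed.

Lemma coord_bound x : exists N, forall l, (N <= l)%N -> coord v x l = 0.
Proof. by have /is_coordP[N c0 _] := coordP x; exists N. Qed.

Lemma coord_expand x N : (forall l, (N <= l)%N -> coord v x l = 0) ->
  x = \sum_(l < N) coord v x l *: v l.
Proof.
move=> c0; have [_ {1}->] := coordP x.
by apply: fsum_ord => l /c0 ->; rewrite scale0r.
Qed.

Lemma coord_of_sum N (c : nat -> R[i]) l :
  coord v (\sum_(k < N) c k *: v k) l = if (l < N)%N then c l else 0.
Proof.
rewrite (@coord_unique _ (fun l => if (l < N)%N then c l else 0)) //.
apply/is_coordP; exists N => [k|]; first by rewrite leqNgt => /negbTE ->.
by apply: eq_bigr => k _; rewrite ltn_ord.
Qed.

Lemma coord_lin a x y l :
  coord v (a *: x + y) l = a * coord v x l + coord v y l.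
Proof.
have [N1 x0] := coord_bound x; have [N2 y0] := coord_bound y.
rewrite (@coord_unique _ (fun l => a * coord v x l + coord v y l)) //.
apply/is_coordP; exists (maxn N1 N2) => [k|].
  by rewrite geq_max => /andP[/x0 -> /y0 ->]; rewrite mulr0 addr0.
rewrite {1}(@coord_expand x (maxn N1 N2)); last first.
  by move=> k; rewrite geq_max => /andP[/x0].
rewrite {1}(@coord_expand y (maxn N1 N2)); last first.
  by move=> k; rewrite geq_max => /andP[_ /y0].
rewrite scaler_sumr -big_split; apply: eq_bigr => k _.
by rewrite scalerDl scalerA.
Qed.

Lemma coord0 l : coord v 0 l = 0.
Proof.
by have := coord_lin (-1) 0 0 l; rewrite scaler0 addr0 mulN1r addNr.
Qed.

Lemma coordZ a x l : coord v (a *: x) l = a * coord v x l.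
Proof. by rewrite -[a *: x]addr0 coord_lin coord0 addr0. Qed.

Lemma coordD x y l : coord v (x + y) l = coord v x l + coord v y l.
Proof. by rewrite -[x]scale1r coord_lin mul1r scale1r. Qed.

Lemma coordN x l : coord v (- x) l = - coord v x l.
Proof. by rewrite -scaleN1r coordZ mulN1r. Qed.

Lemma coord_sum (I : Type) (r : seq I) (P : pred I) (F : I -> V) l :
  coord v (\sum_(i <- r | P i) F i) l = \sum_(i <- r | P i) coord v (F i) l.
Proof.
elim/big_rec2: _ => [|i y x _ <-]; first exact: coord0.
exact: coordD.
Qed.

Lemma coord_basis k l : coord v (v k) l = (l == k)%:R.
Proof.
rewrite (@coord_unique _ (fun l => (l == k)%:R)) //; apply/is_coordP.
exists k.+1 => [j kj|]; first by rewrite gtn_eqF.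
rewrite (bigD1 ord_max) //= eqxx scale1r big1 ?addr0 // => j.
by rewrite -val_eqE /= => /negbTE ->; rewrite scale0r.
Qed.

Lemma coord_inj x y : coord v x = coord v y -> x = y.
Proof.
by move=> xy; have [_ xE] := coordP x; have [_ yE] := coordP y; rewrite xE yE xy.
Qed.

Lemma linear_on_basis (u : nat -> V) :
  exists g : {linear V -> V}, forall l, g (v l) = u l.
Proof.
pose f x := \sum_(l \in [set: nat]) coord v x l *: u l.
have fE x N : (forall l, (N <= l)%N -> coord v x l = 0) ->
    f x = \sum_(l < N) coord v x l *: u l.
  by move=> c0; apply: fsum_ord => l /c0 ->; rewrite scale0r.
have flin : linear f.
  move=> a x y; have [N1 x0] := coord_bound x; have [N2 y0] := coord_bound y.
  have x0' l : (maxn N1 N2 <= l)%N -> coord v x l = 0.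
    by rewrite geq_max => /andP[/x0].
  have y0' l : (maxn N1 N2 <= l)%N -> coord v y l = 0.
    by rewrite geq_max => /andP[_ /y0].
  rewrite (fE _ _ x0') (fE _ _ y0') (fE _ (maxn N1 N2)); last first.
    by move=> l lN; rewrite coord_lin x0' // y0' // mulr0 addr0.
  rewrite scaler_sumr -big_split; apply: eq_bigr => l _.
  by rewrite coord_lin scalerDl scalerA.
pose fL := HB.pack_for {linear V -> V} f (GRing.isLinear.Build _ _ _ _ f flin).
exists fL => l; rewrite /= (fE _ l.+1) => [|k lk].
  rewrite (bigD1 ord_max) //= coord_basis eqxx scale1r big1 ?addr0 // => j.
  by rewrite -val_eqE /= coord_basis => /negbTE ->; rewrite scale0r.
by rewrite coord_basis gtn_eqF.
Qed.

Lemma linear_ext (g h : {linear V -> V}) :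
  (forall l, g (v l) = h (v l)) -> forall x, g x = h x.
Proof.
move=> gh x; have [N x0] := coord_bound x; rewrite (coord_expand x0) !linear_sum.
by apply: eq_bigr => l _; rewrite !linearZ /= gh.
Qed.

Lemma basis_image (g : {linear V -> V}) : bijective g -> is_basis (g \o v).
Proof.
move=> [h hg gh] z; have [c [/is_coordP[N c0 hz] uc]] := bv (h z).
exists c; split.
  apply/is_coordP; exists N => //; rewrite -[z]gh hz linear_sum.
  by apply: eq_bigr => k _; rewrite linearZ.
move=> c' /is_coordP[N' c0' hz']; apply: uc; apply/is_coordP; exists N' => //.
rewrite hz'; apply: (can_inj hg); rewrite gh linear_sum.
by apply: eq_bigr => k _; rewrite linearZ.
Qed.

End Basis.

Lemma coord_image v (g : {linear V -> V}) : is_basis v -> bijective g ->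
  forall x l, coord (g \o v) (g x) l = coord v x l.
Proof.
move=> bv gb x l; have [N x0] := coord_bound bv x.
have -> : g x = \sum_(k < N) coord v x k *: (g \o v) k.
  rewrite {1}(coord_expand bv x0) linear_sum.
  by apply: eq_bigr => k _; rewrite linearZ.
rewrite coord_of_sum; last exact: basis_image.
by case: ltnP => // /x0.
Qed.

Lemma basis_change v u : is_basis v -> is_basis u ->
  exists g : {linear V -> V}, bijective g /\ forall l, g (v l) = u l.
Proof.
move=> bv bu; have [g gE] := linear_on_basis bv u.
have [h hE] := linear_on_basis bu v.
exists g; split => //; exists h => x.
  apply: (@linear_ext _ bv (h \o g) idfun) => l /=.
  by rewrite gE hE.
apply: (@linear_ext _ bu (g \o h) idfun) => l /=.
by rewrite hE gE.
Qed.

Lemma span_basisE v (D : set nat) : is_basis v ->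
  span (v @` D) = [set x | forall l, ~ D l -> coord v x l = 0].
Proof.
move=> bv; apply/seteqP; split.
  apply: smallest_sub.
    split; first by rewrite classical_sets.inE /= => l _; exact: coord0.
    move=> a x y; rewrite !classical_sets.inE /= => hx hy l Dl.
    by rewrite coord_lin // hx // hy // mulr0 addr0.
  move=> _ [k Dk <-] l Dl /=; rewrite coord_basis //.
  by case: eqP => // lk; rewrite lk in Dl.
move=> x /= hx U [[U0 Ulin] DU].
have [N x0] := coord_bound bv x; rewrite (coord_expand bv x0).
apply: big_ind => [|y z Uy Uz|k _]; first by move: U0; rewrite classical_sets.inE.
  have := Ulin 1 y z; rewrite !classical_sets.inE scale1r; exact.
have [Dk|/hx ->] := pselect (D k).
  have := Ulin (coord v x k) (v k) 0; rewrite !classical_sets.inE addr0; apply; last first.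
    by move: U0; rewrite classical_sets.inE.
  by apply: DU; exists k.
by rewrite scale0r; move: U0; rewrite classical_sets.inE.
Qed.

End Coordinates.

(** * Triangular matrices *)

(** Along a periodic orbit [r] can only decrease to its initial value if it is
    constant. This is how permutations and involutions are identified below. *)
Lemma periodic_decreasing (T : Type) (d : Order.disp_t) (A : orderType d)
    (r : T -> A) (p : T -> T) :
  injective r -> (forall x, exists m, iter m.+1 p x = x) ->
  (forall x, (r (p x) <= r x)%O) -> forall x, p x = x.
Proof.
move=> rI per le x; apply: rI; apply: le_anti; rewrite le /=.
have [m pm] := per x; rewrite -{1}pm iterSr.
by elim: m {pm} => [|m IH] //=; exact: le_trans (le _) IH.
Qed.

Lemma periodic_fin (T : finType) (p : T -> T) : injective p ->
  forall x, exists m, iter m.+1 p x = x.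
Proof.
by move=> pI x; exists (fingraph.order p x).-1; rewrite prednK ?order_gt0 // iter_order.
Qed.

Lemma periodic_nat (p : nat -> nat) : injective p ->
  (exists N, forall l, (N <= l)%N -> p l = l) ->
  forall x, exists m, iter m.+1 p x = x.
Proof.
move=> pI [N pN] x; case: (leqP N x) => [/pN px|xN]; first by exists 0%N.
have ltN (i : 'I_N) : (p i < N)%N.
  rewrite ltnNge; apply/negP => Np; have /pI pii := pN _ Np.
  by move: Np; rewrite pii leqNgt ltn_ord.
pose q (i : 'I_N) := Ordinal (ltN i).
have qI : injective q by move=> i j [/pI /val_inj].
have [m qm] := periodic_fin qI (Ordinal xN); exists m.
have qp k : val (iter k q (Ordinal xN)) = iter k p x.
  by elim: k => //= k <-.
by rewrite -qp qm.
Qed.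

(** Some term of the expansion of the determinant does not vanish. *)
Lemma unitmx_perm (F : fieldType) n (T : 'M[F]_n) : T \in unitmx ->
  exists s : 'S_n, forall i, T (s i) i != 0.
Proof.
rewrite unitmxE unitfE -det_tr => dT.
have [s /forallP sP|no] := pickP (fun s : 'S_n => [forall i, T (s i) i != 0]).
  by exists s.
case/eqP: dT; apply: big1 => s _.
have /negbT := no s; rewrite negb_forall => /existsP[i /negPn/eqP Ti].
by rewrite (bigD1 i) //= mxE Ti mul0r mulr0.
Qed.

Section Triangular.
Variables (F : fieldType) (n : nat) (d : Order.disp_t) (A : orderType d).
Variables (r : 'I_n -> A) (rI : injective r).
Implicit Types T M : 'M[F]_n.

Definition triangular T :=
  T \in unitmx /\ forall i j, T i j != 0 -> (r i <= r j)%O.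

Lemma sum_neq0 (I : finType) (f : I -> F) : \sum_i f i != 0 ->
  exists i, f i != 0.
Proof.
move=> s0; have [i fi|f0] := pickP (fun i => f i != 0); first by exists i.
by case/eqP: s0; apply: big1 => i _; apply/eqP; have := f0 i => /= /negbFE.
Qed.

Lemma mulmx_neq0 m p q (B : 'M[F]_(m, p)) (D : 'M[F]_(p, q)) i j :
  (B *m D) i j != 0 -> exists k, B i k != 0 /\ D k j != 0.
Proof.
rewrite mxE => /sum_neq0[k]; rewrite mulf_eq0 negb_or => /andP[? ?].
by exists k.
Qed.

Lemma triangularM T1 T2 : triangular T1 -> triangular T2 ->
  triangular (T1 *m T2).
Proof.
move=> [u1 t1] [u2 t2]; split; first by rewrite unitmx_mul u1.
by move=> i j /mulmx_neq0[k [/t1 ik /t2]]; exact: le_trans.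
Qed.

Lemma triangular1 : triangular 1%:M.
Proof.
split=> [|i j]; first exact: unitmx1.
by rewrite mxE; case: (i =P j) => [->|_]; rewrite ?eqxx ?lexx.
Qed.

Lemma triangular_diag T : triangular T -> forall i, T i i != 0.
Proof.
move=> [/unitmx_perm[s sT] tT] i.
have s1 := periodic_decreasing rI (periodic_fin (@perm_inj _ s))
  (fun i => tT _ _ (sT i)).
by rewrite -{1}(s1 i).
Qed.

Lemma exists_min (P : pred 'I_n) i0 : P i0 ->
  exists2 i, P i & forall j, P j -> (r i <= r j)%O.
Proof. by move=> Pi0; case: (Order.TotalTheory.arg_minP r Pi0) => i; exists i. Qed.

(** The first nonzero entry of a row of the inverse survives in the product with
    [T], so it can only be on the diagonal. *)
Lemma triangular_inv T : triangular T -> triangular (invmx T).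
Proof.
move=> tT; have [uT rT] := tT; split; first by rewrite unitmx_inv.
move=> i j ij.
have [k ik kmin] := @exists_min (fun k => invmx T i k != 0) j ij.
suff -> : i = k by apply: kmin.
have : (invmx T *m T) i k != 0.
  rewrite mxE (bigD1 k) //= big1 ?addr0 => [|l lk].
    by rewrite mulf_neq0 // triangular_diag.
  apply/eqP; rewrite mulf_eq0; case: eqP => //= /eqP il.
  apply/contraT => /rT lk'; case/eqP: lk; apply: rI; apply: le_anti.
  by rewrite lk' kmin.
by rewrite mulVmx // mxE; case: (i =P k) => // _; rewrite eqxx.
Qed.

Lemma triangular_diag_unit T : (forall i, T i i != 0) ->
  (forall i j, T i j != 0 -> (r i <= r j)%O) -> triangular T.
Proof.
move=> dT tT; split => //; rewrite unitmxE unitfE -det_tr.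
rewrite /determinant (bigD1 1%g) //= [X in _ + X]big1 ?addr0 => [|s s1].
  rewrite odd_perm1 mul1r; apply/prodf_neq0 => i _.
  by rewrite mxE perm1.
apply/eqP; rewrite mulf_eq0; apply/orP; right; apply/negPn/negP => /prodf_neq0 sT.
case/eqP: s1; apply/permP => i; rewrite perm1.
apply: (periodic_decreasing rI (periodic_fin (@perm_inj _ s))) => {}i.
by apply: tT; have := sT i isT; rewrite mxE.
Qed.

End Triangular.

(** * Hermitian matrices under triangular congruence *)

Section Hermitian.
Variables (F : fieldType) (theta : {rmorphism F -> F}) (eps : F).
Hypotheses (thetaK : involutive theta) (two_neq0 : 2%:R != 0 :> F).
Variables (n : nat) (d : Order.disp_t) (A : orderType d).
Variables (r : 'I_n -> A) (rI : injective r).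
Implicit Types (T M : 'M[F]_n) (x : 'rV[F]_n).

Definition congruence T M := (map_mx theta T)^T *m M *m T.

Definition hermitian M := forall i j, M i j = eps * theta (M j i).

Lemma congruenceM T1 T2 M : congruence (T1 *m T2) M = congruence T2 (congruence T1 M).
Proof. by rewrite /congruence map_mxM trmx_mul !mulmxA. Qed.

Lemma congruence1 M : congruence 1%:M M = M.
Proof. by rewrite /congruence map_mx1 trmx1 mul1mx mulmx1. Qed.

Lemma congruence_unit T M : T \in unitmx -> M \in unitmx -> congruence T M \in unitmx.
Proof. by move=> uT uM; rewrite !unitmx_mul unitmx_tr map_unitmx uT uM. Qed.

Lemma hermitianE M : hermitian M <-> M = eps *: (map_mx theta M)^T.
Proof.
split=> [hM|hM i j]; first by apply/matrixP => i j; rewrite !mxE.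
by rewrite {1}hM !mxE.
Qed.

Lemma congruence_hermitian T M : hermitian M -> hermitian (congruence T M).
Proof.
rewrite !hermitianE => hM; rewrite /congruence !map_mxM !trmx_mul.
rewrite -map_trmx -map_mx_comp trmxK.
have -> : map_mx (theta \o theta) T = T.
  by apply/matrixP => i j; rewrite mxE /= thetaK.
by rewrite {1}hM -!scalemxAr -scalemxAl mulmxA.
Qed.

Lemma hermitian_sym M i j : hermitian M -> (M i j != 0) = (M j i != 0).
Proof.
have dir k l : hermitian M -> M k l != 0 -> M l k != 0.
  by move=> hM; rewrite hM mulf_eq0 negb_or fmorph_eq0 => /andP[].
by move=> hM; apply/idP/idP; exact: dir.
Qed.

Definition transvection (a : 'I_n) (x : 'rV[F]_n) : 'M[F]_n :=
  1%:M + delta_mx a 0 *m x.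

Lemma mul_transvection_r m (M : 'M_(m, n)) a x i j :
  (M *m transvection a x) i j = M i j + M i a * x 0 j.
Proof.
rewrite mulmxDr mulmx1 mxE mulmxA; congr (_ + _).
by rewrite -colE mxE big_ord1 mxE.
Qed.

Lemma congruence_transvection a x M i j : congruence (transvection a x) M i j =
  M i j + theta (x 0 i) * M a j + (M i a + theta (x 0 i) * M a a) * x 0 j.
Proof.
have E k : (((map_mx theta (transvection a x))^T *m M) i k =
    M i k + theta (x 0 i) * M a k).
  have -> : map_mx theta (transvection a x) = transvection a (map_mx theta x).
    by rewrite map_mxD map_mxM map_mx1 map_delta_mx.
  by rewrite -[M in LHS]trmxK -trmx_mul mxE mul_transvection_r !mxE mulrC.
by rewrite /congruence mul_transvection_r !E.
Qed.

Lemma transvection_triangular a x : x 0 a = 0 ->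
  (forall j, x 0 j != 0 -> (r a <= r j)%O) -> triangular r (transvection a x).
Proof.
move=> xa xr; split.
  suff : transvection a x *m transvection a (- x) = 1%:M by case/mulmx1_unit.
  apply/matrixP => i j; rewrite mul_transvection_r !mxE !big_ord1 !mxE.
  by rewrite xa mulr0 addr0 mulrN eqxx andbT addrK.
move=> i j; rewrite !mxE big_ord1 !mxE.
case: (i =P j) => [-> //|_]; rewrite add0r eqxx andbT.
by case: (i =P a) => [->|]; rewrite ?mul0r ?mul1r ?eqxx // => /xr.
Qed.

Definition partners M i j :=
  (forall l, (M i l != 0) = (l == j)) /\ (forall l, (M j l != 0) = (l == i)).

Definition settled M i := exists j, partners M i j.

Lemma partnersC M i j : partners M i j -> partners M j i.
Proof. by case. Qed.

Lemma partners_settled M i j : partners M i j -> settled M i /\ settled M j.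
Proof. by move=> p; split; [exists j|exists i; exact: partnersC]. Qed.

(** Row [i] is undisturbed because [a] is not the partner of [i], which makes
    [M i a] vanish. *)
Lemma settled_row M i a x l : hermitian M -> settled M i -> ~ settled M a ->
  x 0 i = 0 -> congruence (transvection a x) M i l = M i l.
Proof.
move=> hM [j ij] na xi; rewrite congruence_transvection xi rmorph0 !mul0r !addr0.
suff -> : M i a = 0 by rewrite mul0r addr0.
apply/eqP/negPn/negP; rewrite (proj1 ij) => /eqP aj; apply: na.
by rewrite aj; exists i; exact: partnersC.
Qed.

Lemma settled_transvection M i a x : hermitian M -> settled M i ->
  ~ settled M a -> (forall j, settled M j -> x 0 j = 0) ->
  settled (congruence (transvection a x) M) i.
Proof.
move=> hM si na x0; have [j ij] := si; exists j.
have [_ sj] := partners_settled ij.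
by split=> l; rewrite settled_row ?x0 //; apply ij.
Qed.

Lemma settled_zero M i j : hermitian M -> settled M i -> ~ settled M j ->
  M j i = 0.
Proof.
move=> hM [k ik] nj; apply/eqP/negPn/negP; rewrite hermitian_sym // (proj1 ik).
by move=> /eqP jk; apply: nj; rewrite jk; exists i; exact: partnersC.
Qed.

(** The least unsettled index [a] is paired with the least [k] such that
    [M a k != 0]. By minimality the columns to be cleared come after the pivots,
    so the transvections that clear them are triangular; settled rows vanish at
    the pivots and are not disturbed. *)
Lemma settle_step M : M \in unitmx -> hermitian M ->
  (exists i, ~ settled M i) ->
  exists T, [/\ triangular r T, forall i, settled M i -> settled (congruence T M) i
    & exists i, settled (congruence T M) i /\ ~ settled M i].
Proof.
move=> uM hM [i0 ni0].
have [a /asboolP na amin] := @exists_min _ _ _ r (fun i => `[< ~ settled M i >])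
  i0 (introT (asboolP _) ni0).
have {}amin j : ~ settled M j -> (r a <= r j)%O by move=> /asboolP; apply: amin.
have [j0 Maj0] : exists j, M a j != 0.
  have [s sM] := unitmx_perm uM; exists (s^-1 a)%g.
  by have := sM (s^-1 a)%g; rewrite permKV.
have {j0 Maj0}[k Mak kmin] := @exists_min _ _ _ r (fun j => M a j != 0) j0 Maj0.
have nk : ~ settled M k.
  by move=> /settled_zero -/(_ a hM na) /eqP; apply/negP.
have [ka|ak] := eqVneq k a.
  subst k; pose x := \row_l (if l == a then 0 else - (M a l / M a a)).
  have xz j : settled M j -> x 0 j = 0.
    by move=> sj; rewrite mxE settled_zero // mul0r oppr0 if_same.
  have xa : x 0 a = 0 by rewrite mxE eqxx.
  exists (transvection a x); split=> [|i si|].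
  - apply: transvection_triangular => // j; rewrite mxE.
    have [//|_] := eqVneq j a; first by rewrite eqxx.
    by rewrite oppr_eq0 mulf_eq0 negb_or => /andP[/kmin].
  - exact: settled_transvection.
  exists a; split=> //; exists a.
  suff H l : (congruence (transvection a x) M a l != 0) = (l == a) by split.
  rewrite congruence_transvection xa rmorph0 !mul0r !addr0 mxE.
  have [->|la] := eqVneq l a; first by rewrite mulr0 addr0.
  by rewrite mulrN mulrC divfK // addrN eqxx.
have rak : (r a <= r k)%O by exact: amin.
have Maa : M a a = 0.
  apply/eqP/negPn/negP => /kmin ka; case/eqP: ak; apply: rI; apply: le_anti.
  by rewrite ka rak.
pose x := \row_l (if l == k then 0 else - (M a l / M a k)).
have xz j : settled M j -> x 0 j = 0.
  by move=> sj; rewrite mxE settled_zero // mul0r oppr0 if_same.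
have xk : x 0 k = 0 by rewrite mxE eqxx.
have xa : x 0 a = 0 by rewrite mxE Maa mul0r oppr0 if_same.
pose M1 := congruence (transvection k x) M.
have hM1 : hermitian M1 by exact: congruence_hermitian.
have M1a l : M1 a l = if l == k then M a k else 0.
  rewrite /M1 congruence_transvection xa rmorph0 !mul0r !addr0 mxE.
  have [->|la] := eqVneq l k; first by rewrite mulr0 addr0.
  by rewrite mulrN mulrC divfK // addrN.
have s1 i : settled M i -> settled M1 i.
  by move=> si; apply: settled_transvection.
have M1ka : M1 k a != 0 by rewrite hermitian_sym // M1a eqxx.
have M1aa : M1 a a = 0 by rewrite M1a eq_sym (negbTE ak).
have M1sa i : settled M i -> M1 i a = 0.
  by move=> si; rewrite /M1 settled_row ?xz //; apply/eqP/negPn;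
     rewrite hermitian_sym // settled_zero // eqxx.
have M1sk i : settled M i -> M1 k i = 0.
  move=> si; apply/eqP/negPn; rewrite hermitian_sym // /M1 settled_row ?xz //.
  by rewrite hermitian_sym // settled_zero // eqxx.
(* The entry at [k] receives two contributions, from the row and from the column
   operation: hence the division by two. *)
pose y := \row_l (if l == a then 0 else
  if l == k then - (M1 k k / M1 k a) / 2%:R else - (M1 k l / M1 k a)).
have ya : y 0 a = 0 by rewrite mxE eqxx.
have yz j : settled M j -> y 0 j = 0.
  by move=> sj; rewrite mxE (M1sk _ sj) mul0r oppr0; case: eqP => // _;
     case: eqP => // jk; case: nk; rewrite -jk.
have M2 i l : congruence (transvection a y) M1 i l =
    M1 i l + theta (y 0 i) * M1 a l + M1 i a * y 0 l.
  by rewrite congruence_transvection M1aa mulr0 addr0.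
exists (transvection k x *m transvection a y); split=> [|i si|].
- apply: triangularM; apply: transvection_triangular => // j.
    rewrite mxE; have [//|_] := eqVneq j k; first by rewrite eqxx.
    by rewrite oppr_eq0 mulf_eq0 negb_or => /andP[/kmin].
  by move=> yj; apply: amin => sj; case/eqP: yj; exact: yz.
- rewrite congruenceM -/M1; have [j ij] := si; exists j.
  have [_ sj] := partners_settled ij.
  by split=> l; rewrite M2 yz // rmorph0 mul0r M1sa // mul0r !addr0;
     rewrite /M1 settled_row ?xz //; apply ij.
exists a; split=> //; exists k; rewrite congruenceM -/M1.
have H l : congruence (transvection a y) M1 a l = M1 a l.
  by rewrite M2 ya rmorph0 mul0r M1aa mul0r !addr0.
split=> l; first by rewrite H M1a; case: (l =P k) => // _; rewrite eqxx.
rewrite M2 M1a; have [->|la] := eqVneq l a.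
  by rewrite ya mulr0 addr0 [a == k]eq_sym (negbTE ak) mulr0 addr0.
have [->|lk] := eqVneq l k; last first.
  rewrite mulr0 addr0 [y 0 l]mxE (negbTE la) (negbTE lk) mulrN mulrC divfK //.
  by rewrite addrN eqxx.
apply/negbTE/negPn/eqP.
have ykE : M1 k a * y 0 k = - M1 k k / 2%:R.
  by rewrite [y 0 k]mxE (negbTE ak) eqxx; field; rewrite M1ka two_neq0.
have -> : theta (y 0 k) * M a k = - M1 k k / 2%:R.
  have -> : M a k = eps * theta (M1 k a).
    by rewrite -hM1 M1a eqxx.
  rewrite mulrCA -rmorphM [y 0 k * _]mulrC ykE rmorphM rmorphN fmorphV rmorph_nat.
  by rewrite mulrA mulrN -hM1.
by rewrite ykE; field.
Qed.

(** The indices are settled one pair at a time. With [theta] the identity this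
    applies to bilinear forms; with [theta] the conjugation it contains the
    Gram-Schmidt process. *)
Lemma hermitian_monomial M : M \in unitmx -> hermitian M ->
  exists T w, [/\ triangular r T, involutive w
    & forall i j, (congruence T M i j != 0) = (j == w i)].
Proof.
move=> uM hM.
suff [T tT sT] : exists2 T, triangular r T & forall i, settled (congruence T M) i.
  have [w wP] := choice sT; exists T, w; split => // [i|i j].
    by apply/eqP; rewrite eq_sym -(proj1 (wP (w i))) (proj2 (wP i)).
  by rewrite (proj1 (wP i)).
have [m] := ubnP #|[pred i | `[< ~ settled M i >]]|.
elim: m M uM hM => // m IH M uM hM; rewrite ltnS => lem.
have [/asboolP all|] := boolP `[< forall i, settled M i >].
  by exists 1%:M => [|i]; [exact: triangular1|rewrite congruence1].
move=> /asboolP /existsNP nall.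
have [T [tT sT [i [si ni]]]] := settle_step uM hM nall.
have uT := proj1 tT.
have [||//|T' tT' sT'] := IH (congruence T M).
- exact: congruence_unit.
- exact: congruence_hermitian.
- apply: leq_trans lem; apply: proper_card; apply/properP; split.
    apply/fintype.subsetP => j; rewrite !inE => /asboolP nj; apply/asboolP.
    by move=> /sT.
  by exists i; rewrite inE; [apply/asboolP|apply/asboolP => /(_ si)].
by exists (T *m T') => [|j]; [exact: triangularM|rewrite congruenceM].
Qed.

End Hermitian.

(** * Leading indices and conjugations *)

Section Conjugation.
Variables (R : realType) (n : nat) (d : Order.disp_t) (A : orderType d).
Variables (r : 'I_n -> A) (rI : injective r).
Variables (M : 'M[R[i]]_n) (eps : R[i]).
Hypotheses (eps1 : eps = 1 \/ eps = -1) (MM : M *m map_mx conjc M = eps%:M).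
Implicit Types x y : 'cV[R[i]]_n.

Let g x := M *m map_mx conjc x.

Let eps_neq0 : eps != 0.
Proof. by case: eps1 => ->; rewrite ?oppr_eq0 oner_eq0. Qed.

Let gg x : g (g x) = eps *: x.
Proof.
rewrite /g map_mxM mulmxA MM mul_scalar_mx; congr (_ *: _).
apply/matrixP => i j; rewrite !mxE; exact: conjcK.
Qed.

Let gB x y c : g (x - c *: y) = g x - c^*%C *: g y.
Proof. by rewrite /g map_mxB map_mxZ mulmxBr scalemxAr. Qed.

Let subE x y c i : (x - c *: y) i 0 = x i 0 - c * y i 0.
Proof. by rewrite !mxE. Qed.

Let addE x y i : (x + y) i 0 = x i 0 + y i 0.
Proof. by rewrite mxE. Qed.

Let scaleE x c i : (c *: x) i 0 = c * x i 0.
Proof. by rewrite mxE. Qed.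

Let g0 x : g x = 0 -> x = 0.
Proof.
move=> gx; have := gg x; rewrite gx /g map_mx0 mulmx0 => /esym/eqP.
by rewrite scaler_eq0 (negbTE eps_neq0) => /eqP.
Qed.

Definition has_lead x k := x k 0 != 0 /\ forall i, x i 0 != 0 -> (r i <= r k)%O.

Lemma has_lead_neq0 x k : has_lead x k -> x <> 0.
Proof. by move=> [+ _] x0; rewrite x0 mxE eqxx. Qed.

Lemma exists_lead x : x <> 0 -> exists k, has_lead x k.
Proof.
move=> x0; have [k xk] : exists k, x k 0 != 0.
  apply: contrapT => /forallNP xz; apply: x0; apply/matrixP => i j.
  by rewrite ord1 mxE; apply/eqP/negPn/negP => /xz.
case: (@Order.TotalTheory.arg_maxP _ _ _ k (fun k => x k 0 != 0) r xk) => i xi imax.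
by exists i.
Qed.

Lemma has_leadZ c x k : c != 0 -> has_lead x k -> has_lead (c *: x) k.
Proof.
move=> c0 [xk xi]; split=> [|i]; first by rewrite mxE mulf_neq0.
by rewrite mxE mulf_eq0 negb_or => /andP[_ /xi].
Qed.

Lemma has_lead_cancel x y k : has_lead x k -> has_lead y k ->
  exists2 c, c != 0 & forall i, (x - c *: y) i 0 != 0 -> (r i < r k)%O.
Proof.
move=> [xk xi] [yk yi]; exists (x k 0 / y k 0).
  by rewrite mulf_neq0 ?invr_eq0.
move=> i; rewrite !mxE => h; rewrite lt_neqAle.
have -> /= : r i != r k.
  by apply/eqP => /rI ik; case/eqP: h; rewrite ik divfK ?subrr.
have [xi0|/xi //] := eqVneq (x i 0) 0.
by apply: yi; apply: contraNneq h => ->; rewrite xi0 mulr0 subrr.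
Qed.

Definition attains j k := exists2 x, has_lead x j & has_lead (g x) k.

Lemma attains_sym j k : attains j k -> attains k j.
Proof.
by move=> [x xj gx]; exists (g x) => //; rewrite gg; exact: has_leadZ.
Qed.

Definition least_attained j k :=
  attains j k /\ forall l, attains j l -> (r k <= r l)%O.

Lemma exists_least_attained j : exists k, least_attained j k.
Proof.
pose x : 'cV[R[i]]_n := delta_mx j 0.
have xj : has_lead x j.
  split=> [|i]; first by rewrite mxE !eqxx oner_eq0.
  by rewrite mxE andbT; case: (i =P j) => [->|]; rewrite ?lexx ?eqxx.
have [|k gk] := @exists_lead (g x); first by move=> /g0; exact: has_lead_neq0 xj.
have [l /asboolP jl lmin] := @exists_min _ _ _ r (fun l => `[< attains j l >]) k
  (introT (asboolP _) (ex_intro2 _ _ x xj gk)).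
by exists l; split => // i ji; apply: lmin; apply/asboolP.
Qed.

(** Suppose that [j] comes before [j'] and that the images of [x] and [x'], with
    leading indices [j] and [j'], both lead at [k]. Subtracting a multiple of [x]
    from [x'] keeps the leading index [j'] and lowers that of the image. *)
Lemma least_attained_inj j j' k : least_attained j k -> least_attained j' k -> j = j'.
Proof.
wlog jj' : j j' / (r j <= r j')%O => [wl|].
  by case: (leP (r j) (r j')) => [/wl|/ltW /wl] h ? ?; [|apply/esym]; exact: h.
move=> [[x xj gx] _] [[x' xj' gx'] kmin]; apply: contrapT => nj.
have {}jj' : (r j < r j')%O.
  by rewrite lt_neqAle jj' andbT; apply/eqP => /rI.
have [c c0 cP] := has_lead_cancel gx' gx.
pose z := x' - c^*%C *: x.
have zj : has_lead z j'.
  split.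
    rewrite !mxE; have -> : x j' 0 = 0.
      by apply/eqP/negPn/negP => /(proj2 xj); rewrite leNgt jj'.
    by rewrite mulr0 subr0; case: xj'.
  move=> i; have [xi0|/(proj2 xj) ij _] := eqVneq (x i 0) 0.
    by rewrite !mxE xi0 mulr0 subr0; exact: (proj2 xj').
  exact: le_trans ij (ltW jj').
have [|l gl] := @exists_lead (g z); first by move=> /g0; exact: has_lead_neq0 zj.
have : (r k <= r l)%O by apply: kmin; exists z.
rewrite leNgt; apply/negP/negPn; apply: cP.
by move: (proj1 gl); rewrite gB conjcK.
Qed.

(** Let [w j] be the least leading index of [g x], for [x] with leading index [j].
    Then [w] is injective, and [r (w (w j)) <= r j] because [g] is involutive up
    to a scalar; hence [w] is an involution. The columns of [T] are minimizers
    [x j] and their images under [g], except at the fixed points of [w], where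
    they are vectors fixed by [g]. *)
Lemma conjugation_monomial : exists (T : 'M[R[i]]_n) w,
  [/\ triangular r T, involutive w, eps = -1 -> forall i, w i <> i &
      forall j, exists2 s, s = 1 \/ s = -1 &
        col j (M *m map_mx conjc T) = s *: col (w j) T].
Proof.
have [w wP] := choice exists_least_attained.
have wI : injective w by move=> i j ij; apply: (@least_attained_inj i j (w i)); rewrite // ij.
have wK : involutive w.
  have le j : (r (w (w j)) <= r j)%O.
    by apply: (proj2 (wP (w j))); apply: attains_sym; case: (wP j).
  exact: (periodic_decreasing rI (periodic_fin (inj_comp wI wI)) le).
have [|x xP] := @choice _ _
    (fun j (x : 'cV[R[i]]_n) => has_lead x j /\ has_lead (g x) (w j)).
  by move=> j; have [[x xj gx] _] := wP j; exists x.
have [|y yP] := @choice _ _ (fun j (y : 'cV[R[i]]_n) =>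
    w j = j -> [/\ eps = 1, has_lead y j & g y = y]).
  move=> j; have [wj|nj] := pselect (w j = j); last by exists 0.
  have [xj gxj] := xP j; rewrite wj in gxj.
  have [c c0 cP] := has_lead_cancel gxj xj; set z := g (x j) - c *: x j in cP.
  have zE : g (x j) j 0 = c * x j j 0.
    apply/eqP; rewrite -subr_eq0; apply: contraT => h.
    by have := cP j; rewrite subE h ltxx => /(_ isT).
  have gzE : g z = eps *: x j - c^*%C *: g (x j) by rewrite gB gg.
  (* The leading coefficient of [g (g x)] is [c * c^*] times that of [x], which
     excludes fixed points when [eps = -1]. *)
  have eps_cc : eps = c * c^*%C.
    have : g z j 0 = 0.
      apply/eqP/contraT => gzj.
      have [|l zl] := @exists_lead z.
        by move=> z0; case/eqP: gzj; rewrite z0 /g map_mx0 mulmx0 mxE.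
      have : (r (w j) <= r l)%O.
        apply: (proj2 (wP j)); apply: attains_sym; exists z => //; split => // i.
        rewrite gzE subE scaleE => h.
        have [xi0|/(proj2 xj) //] := eqVneq (x j i 0) 0.
        by apply: (proj2 gxj); apply: contraNneq h => ->; rewrite xi0 !mulr0 subr0.
      by rewrite wj leNgt (cP l (proj1 zl)).
    rewrite gzE subE scaleE zE mulrA -mulrBl => /eqP; rewrite mulf_eq0 (negbTE (proj1 xj)).
    by rewrite orbF subr_eq0 mulrC => /eqP.
  have e1 : eps = 1.
    case: eps1 => // eN; have := mulcJ_ge0 c.
    by rewrite -eps_cc eN oppr_ge0 ler10.
  (* The scalar [a] prevents the leading terms of [a x] and [g (a x)] from
     cancelling in the fixed vector [a x + g (a x)]. *)
  have [a ac] : exists a : R[i], a + a^*%C * c != 0.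
    have [c1|] := eqVneq (1 + c) 0; last by exists 1; rewrite conjc1 mul1r.
    exists 'i%C; have -> : c = -1 by apply/eqP; rewrite -addr_eq0 addrC c1.
    rewrite mulrN1 subcJ /= !mulf_neq0 ?pnatr_eq0 ?oner_neq0 //.
    by rewrite eq_complex /= oner_eq0 andbF.
  have gZ b u : g (b *: u) = b^*%C *: g u by rewrite /g map_mxZ scalemxAr.
  exists (a *: x j + g (a *: x j)) => _; split=> //; first split.
  - by rewrite gZ addE !scaleE zE mulrA -mulrDl mulf_neq0 // (proj1 xj).
  - move=> i; rewrite gZ addE !scaleE => h.
    have [xi0|/(proj2 xj) //] := eqVneq (x j i 0) 0.
    by apply: (proj2 gxj); apply: contraNneq h => ->; rewrite xi0 !mulr0 addr0.
  by rewrite {1}/g map_mxD mulmxDr -!/(g _) gg e1 scale1r addrC.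
pose t j := if w j == j then y j else
            if (r j < r (w j))%O then x j else g (x (w j)).
have tj j : has_lead (t j) j.
  rewrite /t; case: eqP => [/yP[]//|_]; case: ifP => _; first by case: (xP j).
  by have [_] := xP (w j); rewrite wK.
pose T : 'M_n := \matrix_(i, j) t j i 0.
have colT j : col j T = t j by apply/matrixP => i k; rewrite !mxE ord1.
exists T, w; split=> //.
- apply: triangular_diag_unit => // [i|i j]; rewrite mxE; first by case: (tj i).
  exact: (proj2 (tj j)).
- move=> eN i /yP[e1 _ _]; have : (-1 : R[i]) = 1 by rewrite -eN e1.
  by move/eqP; rewrite eq_sym -subr_eq0 opprK (pnatr_eq0 _ 2).
move=> j; have -> : col j (M *m map_mx conjc T) = g (t j).
  by rewrite -colT /g map_col !colE mulmxA.
rewrite colT /t wK (eq_sym j); case: eqP => [wj|/eqP wj].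
  by exists 1; [left|case: (yP j wj) => _ _ ->; rewrite scale1r wj].
case: (ltgtP (r j) (r (w j))) => [jw|jw|/rI jw].
- by exists 1; [left|rewrite scale1r].
- by exists eps; rewrite ?gg.
- by case/eqP: wj.
Qed.

End Conjugation.

(** * Unitary matrices and phases *)

Section HalfPhase.
Variable R : realType.
Implicit Type m : nat -> R[i].

(** A square root of [m] for the product [c i * c (w i)], up to exchanging the
    values of [m] at [i] and [w i]. It equals one wherever [m] does, so that
    rescaled bases stay standard almost everywhere. *)
Definition half_phase (w : nat -> nat) m (i : nat) : R[i] :=
  if w i == i then sqrtC (m i) else if (i < w i)%N then m i else 1.

Lemma half_phaseM w m i : involutive w ->
  half_phase w m i * half_phase w m (w i) = m i \/
  half_phase w m i * half_phase w m (w i) = m (w i).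
Proof.
move=> wK; rewrite /half_phase wK (eq_sym i).
case: eqP => [->|/eqP wi]; first by left; rewrite -expr2 sqrtCK.
by case: ltngtP wi => // _ _; [left; rewrite mulr1|right; rewrite mul1r].
Qed.

Lemma half_phase1 w m i : m i = 1 -> half_phase w m i = 1.
Proof. by move=> mi; rewrite /half_phase mi sqrtC1 !if_same. Qed.

Lemma half_phase_neq0 w m i : m i != 0 -> half_phase w m i != 0.
Proof.
rewrite /half_phase => mi; case: ifP => _; first by rewrite sqrtC_eq0.
by case: ifP; rewrite ?oner_eq0.
Qed.

Lemma half_phase_norm w m i : `|m i| = 1 -> `|half_phase w m i| = 1.
Proof.
move=> mi; rewrite /half_phase; case: ifP => _; last by case: ifP; rewrite ?normr1.
by apply/eqP; rewrite -(@eqrXn2 _ 2) // -normrX sqrtCK mi expr1n.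
Qed.

End HalfPhase.

Section Unitary.
Variables (R : realType) (n : nat) (d : Order.disp_t) (A : orderType d).
Variables (r : 'I_n -> A) (rI : injective r).
Local Notation C := R[i].
Local Notation cj := (@conjc R : {rmorphism C -> C}).
Local Notation bar := (map_mx conjc).
Local Notation unitary Q := ((bar Q)^T *m Q = 1%:M).
Implicit Types P Q M N T : 'M[C]_n.

Definition signed_monomial (w : 'I_n -> 'I_n) N := forall i j,
  (i <> w j -> N i j = 0) /\ (i = w j -> N i j = 1 \/ N i j = -1).

Lemma barK Q : bar (bar Q) = Q.
Proof. by apply/matrixP => i j; rewrite !mxE; exact: conjcK. Qed.

Lemma unitary_diag Q j : unitary Q -> \sum_k (Q k j)^*%C * Q k j = 1.
Proof.
move=> /matrixP/(_ j j); rewrite !mxE eqxx mulr1n => <-.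
by apply: eq_bigr => k _; rewrite !mxE.
Qed.

Lemma unitaryM P Q : unitary P -> unitary Q -> unitary (P *m Q).
Proof.
by move=> uP uQ; rewrite map_mxM trmx_mul mulmxA -(mulmxA _ _ P) uP mulmx1.
Qed.

Lemma unitary_unit Q : unitary Q -> Q \in unitmx.
Proof. by case/mulmx1_unit. Qed.

Lemma unitaryV Q : unitary Q -> invmx Q = (bar Q)^T.
Proof. by move=> uQ; rewrite -[LHS]mul1mx -uQ mulmxK // unitary_unit. Qed.

Lemma unitary_mulmxC Q : unitary Q -> Q *m (bar Q)^T = 1%:M.
Proof. exact: mulmx1C. Qed.

Lemma invmxM P Q : P \in unitmx -> Q \in unitmx ->
  invmx (P *m Q) = invmx Q *m invmx P.
Proof.
move=> uP uQ; have uPQ : P *m Q \in unitmx by rewrite unitmx_mul uP.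
rewrite -[RHS](mulKmx uPQ) -!mulmxA (mulmxA Q) mulmxV // mul1mx mulmxV //.
by rewrite mulmx1.
Qed.

Lemma bar_unitary Q : unitary Q -> Q^T *m bar Q = 1%:M.
Proof.
move=> uQ; have := congr1 (fun M => bar M) uQ.
by rewrite map_mxM map_mx1 map_trmx barK.
Qed.

Lemma triangular_diag_mx (D : 'rV[C]_n) : (forall i, D 0 i != 0) ->
  triangular r (diag_mx D).
Proof.
move=> D0; apply: triangular_diag_unit => // [i|i j].
  by rewrite mxE eqxx mulr1n.
by rewrite mxE; case: (i =P j) => [->|]; rewrite ?mulr0n ?eqxx ?lexx.
Qed.

(** Gram-Schmidt orthonormalization, from the reduction of the positive definite
    Gram matrix of [P]: a monomial positive definite matrix is diagonal. *)
Lemma gram_schmidt P : P \in unitmx ->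
  exists2 T, triangular r T & unitary (P *m T).
Proof.
move=> uP; pose H := congruence cj P 1%:M.
have hH : hermitian cj 1 H.
  apply: congruence_hermitian; first exact: conjcK.
  move=> i j; rewrite mul1r !mxE eq_sym; exact: (esym (conjc_nat _ _)).
have uH : H \in unitmx by rewrite congruence_unit // unitmx1.
have [||T [w [tT _ Tw]]] := @hermitian_monomial _ cj 1 _ _ _ _ _ _ rI H uH hH.
- exact: conjcK.
- by rewrite pnatr_eq0.
have GE : congruence cj T H = (bar (P *m T))^T *m (P *m T).
  by rewrite -congruenceM /congruence mulmx1.
set Q := P *m T in GE; set G' := congruence cj T H in Tw GE; clearbody G'.
have GiiE i : G' i i = \sum_k (Q k i) * (Q k i)^*%C.
  by rewrite GE mxE; apply: eq_bigr => k _; rewrite !mxE mulrC.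
have Gii_ge0 i : 0 <= G' i i.
  by rewrite GiiE; apply: sumr_ge0 => k _; exact: mulcJ_ge0.
have uQ : Q \in unitmx by rewrite unitmx_mul uP; case: tT.
have Gii i : G' i i != 0.
  apply/eqP => /eqP; rewrite GiiE psumr_eq0 => [/allP Q0|k _]; last exact: mulcJ_ge0.
  have [s sQ] := unitmx_perm uQ.
  have := Q0 (s i) (mem_index_enum _); rewrite /= mulf_eq0 conjc_eq0 orbb.
  by rewrite (negbTE (sQ i)).
have wi i : w i = i by apply/eqP; rewrite eq_sym -Tw.
pose D : 'rV[C]_n := \row_i (sqrtC (G' i i))^-1.
have D0 i : D 0 i != 0 by rewrite mxE invr_eq0 sqrtC_eq0.
have DJ i : (D 0 i)^*%C = D 0 i.
  have : 0 <= D 0 i by rewrite mxE invr_ge0 sqrtC_ge0.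
  by move=> /ger0_real/conj_Creal.
exists (T *m diag_mx D).
  by apply: triangularM => //; exact: triangular_diag_mx.
have -> : (bar (P *m (T *m diag_mx D)))^T *m (P *m (T *m diag_mx D)) =
    (bar (diag_mx D))^T *m G' *m diag_mx D.
  by rewrite GE [P *m (_ *m _)]mulmxA -/Q map_mxM trmx_mul !mulmxA.
rewrite map_diag_mx tr_diag_mx; apply/matrixP => i j.
rewrite mul_mx_diag mul_diag_mx !mxE; case: (i =P j) => [<-|/eqP ij].
  have := DJ i; rewrite mxE /= => ->; rewrite mulrAC -invfM -expr2 sqrtCK.
  by rewrite mulVf.
have -> : G' i j = 0 by apply/eqP/negPn; rewrite Tw wi eq_sym (negbTE ij).
by rewrite mulr0 mul0r.
Qed.

(** Let [B] be the group of triangular matrices. A unitary [M] in [B w B] whose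
    conjugate lies in [B^T w B] is monomial: along the flag, column [j] of [M] vanishes above row [w j] by one condition, below
    it by the other, and on the rows already used by orthogonality. *)
Lemma unitary_is_monomial M T1 T2 (w : 'I_n -> 'I_n) :
  unitary M -> triangular r T1 -> triangular r T2 ->
  (forall i j, (T1^T *m bar M *m T1) i j != 0 -> i = w j) ->
  (forall i j, (invmx T2 *m M *m bar T2) i j != 0 -> i = w j) ->
  forall i j, M i j != 0 -> i = w j.
Proof.
move=> uM t1 t2 h1 h2.
have [/asboolP //|] := boolP `[< forall i j, M i j != 0 -> i = w j >].
move=> /asboolP no; exfalso.
pose bad j := exists l, M l j != 0 /\ l <> w j.
have [j0 bj0] : exists j, bad j.
  apply: contrapT => /forallNP nb; apply: no => i j Mij; apply: contrapT => ij.
  by apply: (nb j); exists i.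
have [j /asboolP [l [Mlj lw]] jmin] := @exists_min _ _ _ r (fun j => `[< bad j >])
  j0 (introT (asboolP _) bj0).
have ok i k : (r i < r j)%O -> M k i != 0 -> k = w i.
  move=> ij Mki; apply: contrapT => kw.
  have : (r j <= r i)%O by apply: jmin; apply/asboolP; exists k.
  by rewrite leNgt ij.
have Ml0 i : (r i < r j)%O -> M l i = 0.
  move=> ij; apply/eqP/contraT => Mli.
  have lE := ok _ _ ij Mli.
  have /matrixP/(_ i j) := uM; rewrite mxE (bigD1 l) //= big1 => [|k kl].
    rewrite !mxE addr0 => /eqP; case: (i =P j) ij => [->|_ _]; first by rewrite ltxx.
    by rewrite mulf_eq0 conjc_eq0 (negbTE Mli) (negbTE Mlj).
  rewrite !mxE; have [->|/(ok _ _ ij) kE] := eqVneq (M k i) 0.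
    by rewrite conjc0 mul0r.
  by case/eqP: kl; rewrite kE lE.
have lwj : (r l <= r (w j))%O.
  have : (M *m bar T2) l j != 0.
    rewrite mxE (bigD1 j) //= big1 ?addr0 => [|i ij].
      by rewrite mxE mulf_neq0 ?conjc_eq0 // (triangular_diag rI t2).
    rewrite mxE; have [->|/(proj2 t2) ij'] := eqVneq (T2 i j) 0.
      by rewrite conjc0 mulr0.
    rewrite Ml0 ?mul0r // lt_neqAle ij' andbT; apply: contraNneq ij => /rI ->.
    by rewrite eqxx.
  rewrite -{1}(mulKVmx (proj1 t2) M) -!mulmxA => /mulmx_neq0[k [lk]].
  by rewrite mulmxA => /h2 kw; rewrite kw in lk; exact: (proj2 t2).
have wjl : (r (w j) <= r l)%O.
  have : (bar M *m T1) l j != 0.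
    rewrite mxE (bigD1 j) //= big1 ?addr0 => [|i ij].
      by rewrite mxE mulf_neq0 ?conjc_eq0 // (triangular_diag rI t1).
    rewrite mxE; have [->|/(proj2 t1) ij'] := eqVneq (T1 i j) 0.
      by rewrite mulr0.
    rewrite Ml0 ?conjc0 ?mul0r // lt_neqAle ij' andbT.
    by apply: contraNneq ij => /rI ->; rewrite eqxx.
  have uT1 : T1^T \in unitmx by rewrite unitmx_tr; case: t1.
  rewrite -{1}(mulKmx uT1 (bar M)) -!mulmxA => /mulmx_neq0[k [lk]].
  rewrite mulmxA => /h1 kw; rewrite kw -trmx_inv mxE in lk.
  exact: (proj2 (triangular_inv rI t1)).
by apply: lw; apply: rI; apply: le_anti; rewrite lwj wjl.
Qed.

(** The entries [m j] of [M] have modulus one and satisfy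
    [(m (w j))^* * m j = eps], so the phases given by [half_phase] turn each of
    them into a sign. *)
Lemma normalize_phases M (w : 'I_n -> 'I_n) eps : involutive w ->
  eps = 1 \/ eps = -1 -> unitary M -> M *m bar M = eps%:M ->
  (forall i j, M i j != 0 -> i = w j) ->
  exists D : 'rV[C]_n, [/\ forall i, D 0 i != 0, unitary (diag_mx D)
    & signed_monomial w ((bar (diag_mx D))^T *m M *m bar (diag_mx D))].
Proof.
move=> wK eps1 uM MM Mw.
pose m (k : nat) : C := if insub k is Some j then M (w j) j else 1.
pose wn (k : nat) : nat := if insub k is Some j then w j else k.
have mE (j : 'I_n) : m j = M (w j) j by rewrite /m valK.
have wnE (j : 'I_n) : wn j = w j by rewrite /wn valK.
have wnK : involutive wn.
  move=> k; rewrite {2}/wn; case: insubP => [j _ <-|/negbTE kn].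
    by rewrite wnE wK.
  by rewrite /wn insubF.
have Mm (j : 'I_n) : (m j)^*%C * m j = 1.
  rewrite -(unitary_diag j uM) (bigD1 (w j)) //= big1 ?addr0 ?mE // => k kw.
  have -> : M k j = 0 by apply/eqP/contraT => /Mw kE; rewrite kE eqxx in kw.
  by rewrite mulr0.
have Mme (j : 'I_n) : (m (w j))^*%C * m j = eps.
  have /matrixP/(_ (w j) (w j)) := MM; rewrite !mxE eqxx mulr1n => <-.
  rewrite (bigD1 j) //= big1 ?addr0 => [|k kj].
    by rewrite !mE wK mxE mulrC.
  have -> : M (w j) k = 0; last by rewrite mul0r.
  by apply/eqP/contraT => /Mw /(can_inj wK) kE; rewrite kE eqxx in kj.
have mn (j : 'I_n) : `|m j| = 1.
  by apply/eqP; rewrite -(@eqrXn2 _ 2) // sqr_normc mulrC Mm expr1n.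
pose c := half_phase wn m.
have cn (j : 'I_n) : (c j)^*%C * c j = 1.
  by rewrite mulrC -sqr_normc half_phase_norm ?expr1n.
exists (\row_j c j); split.
- by move=> i; rewrite mxE -normr_eq0 half_phase_norm ?oner_eq0.
- rewrite map_diag_mx tr_diag_mx mulmx_diag; apply/matrixP => i j.
  by rewrite !mxE; case: (i =P j) => [_|]; rewrite ?mulr0n ?cn.
rewrite map_diag_mx tr_diag_mx => i j; rewrite mul_mx_diag mul_diag_mx !mxE.
split=> [iw|->].
  have -> : M i j = 0 by apply/eqP/contraT => /Mw.
  by rewrite mulr0 mul0r.
rewrite -mE mulrAC -rmorphM /= mulrC -wnE.
have [|] := half_phaseM m j wnK; rewrite -/c mulrC [c j * _]mulrC => ->.
  by rewrite Mm; left.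
by rewrite wnE Mme.
Qed.

Lemma signed_monomial_bar w N : signed_monomial w N -> signed_monomial w (bar N).
Proof.
move=> sN i j; split=> h; rewrite mxE; first by rewrite (proj1 (sN i j)) ?conjc0.
case: (proj2 (sN i j) h) => ->; [left; exact: conjc1|right].
exact: (rmorphN1 cj).
Qed.

(** The columns of [P] form a basis dual for [w] and those of [P *m X] a basis
    conjugate for [w] of the same flag. For an orthonormal basis of this flag both
    properties become conditions on a single unitary matrix, which is therefore
    monomial, and it remains to adjust phases. *)
Lemma dual_conjugate_reduction (Om P X : 'M[C]_n) (w : 'I_n -> 'I_n) eps :
  involutive w -> eps = 1 \/ eps = -1 ->
  bar Om = Om -> unitary Om -> Om *m Om = eps%:M ->
  P \in unitmx -> triangular r X ->
  signed_monomial w (P^T *m Om *m P) ->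
  signed_monomial w (invmx (P *m X) *m Om *m bar (P *m X)) ->
  exists T, [/\ triangular r T,
    signed_monomial w ((P *m T)^T *m Om *m (P *m T)) &
    signed_monomial w (invmx (P *m T) *m Om *m bar (P *m T))].
Proof.
move=> wK eps1 Omr uOm OmOm uP tX dP cX.
have [T tT uU] := gram_schmidt uP.
have [U UE] : exists U, U = P *m T by eexists.
rewrite -UE in uU.
have uU' : U \in unitmx by exact: unitary_unit.
pose M := (bar U)^T *m Om *m bar U.
have barM : bar M = U^T *m Om *m U by rewrite /M !map_mxM map_trmx !barK Omr.
have uM : unitary M.
  rewrite barM !trmx_mul trmxK /M !mulmxA -(mulmxA _ U) unitary_mulmxC //.
  rewrite mulmx1 -(mulmxA _ Om^T) -[in Om^T]Omr uOm mulmx1.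
  by rewrite bar_unitary.
have MM : M *m bar M = eps%:M.
  rewrite barM /M !mulmxA -(mulmxA _ (bar U)) -[bar U *m _]trmxK trmx_mul trmxK.
  by rewrite unitary_mulmxC // trmx1 mulmx1 -(mulmxA _ Om Om) OmOm -mulmxA
     mul_scalar_mx -scalemxAr uU scalemx1.
have tT' := triangular_inv rI tT.
have Mw i j : M i j != 0 -> i = w j.
  apply: (@unitary_is_monomial M (invmx T) (invmx T *m X) w) => //.
  - exact: triangularM.
  - move=> {}i {}j; have -> : (invmx T)^T *m bar M *m invmx T = P^T *m Om *m P.
      by rewrite barM UE trmx_mul trmx_inv !mulmxA mulVmx ?unitmx_tr ?(proj1 tT) //
         mul1mx mulmxK // (proj1 tT).
    by move=> h; apply: contrapT => /(proj1 (dP i j)) z; rewrite z eqxx in h.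
  move=> {}i {}j; have -> : invmx (invmx T *m X) *m M *m bar (invmx T *m X) =
      invmx (P *m X) *m Om *m bar (P *m X).
    have uB : invmx T *m X \in unitmx.
      by rewrite unitmx_mul unitmx_inv (proj1 tT) (proj1 tX).
    have -> : P *m X = U *m (invmx T *m X).
      by rewrite UE mulmxA mulmxK // (proj1 tT).
    move: (invmx T *m X) uB => B uB; rewrite invmxM // ?unitary_unit //.
    by rewrite (unitaryV uU) map_mxM /M !mulmxA.
  by move=> h; apply: contrapT => /(proj1 (cX i j)) z; rewrite z eqxx in h.
have [D [D0 uD sD]] := normalize_phases wK eps1 uM MM Mw.
exists (T *m diag_mx D); rewrite [P *m (_ *m _)]mulmxA -UE; split.
- by apply: triangularM => //; exact: triangular_diag_mx.
- rewrite -[Q in signed_monomial w Q]barK; apply: signed_monomial_bar.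
  have -> : bar ((U *m diag_mx D)^T *m Om *m (U *m diag_mx D)) =
      (bar (diag_mx D))^T *m M *m bar (diag_mx D).
    by rewrite /M !map_mxM -map_trmx map_mxM trmx_mul Omr !mulmxA.
  exact: sD.
- rewrite unitaryV ?(unitaryM uU uD) //.
  have -> : (bar (U *m diag_mx D))^T *m Om *m bar (U *m diag_mx D) =
      (bar (diag_mx D))^T *m M *m bar (diag_mx D).
    by rewrite /M !map_mxM trmx_mul !mulmxA.
  exact: sD.
Qed.

End Unitary.

(** * Signed monomial normal forms *)

Section SignedReductions.
Variables (R : realType) (n : nat) (d : Order.disp_t) (A : orderType d).
Variables (r : 'I_n -> A) (rI : injective r).
Local Notation C := R[i].
Local Notation bar := (map_mx conjc).
Implicit Types M T : 'M[C]_n.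
Variable eps : C.
Hypothesis eps1 : eps = 1 \/ eps = -1.

(** Square roots of complex numbers scale the nonzero entries of the monomial
    form to signs. *)
Lemma symmetric_signed_monomial M : M \in unitmx -> M^T = eps *: M ->
  exists T w, [/\ triangular r T, involutive w,
    eps = -1 -> forall i, w i <> i & signed_monomial w (T^T *m M *m T)].
Proof.
move=> uM Mt.
have two0 : 2%:R != 0 :> C by rewrite pnatr_eq0.
have hM : hermitian (idfun : {rmorphism C -> C}) eps M.
  by move=> i j; have /matrixP/(_ j i) := Mt; rewrite !mxE.
have idK : involutive (idfun : {rmorphism C -> C}) by [].
have [T [w [tT wK]]] := hermitian_monomial idK two0 rI uM hM.
have := congruence_hermitian idK T hM.
rewrite /congruence map_mx_id //; set N := _ *m _ *m _ => hN Nw.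
have Ncongr D : (T *m D)^T *m M *m (T *m D) = D^T *m N *m D.
  by rewrite trmx_mul /N !mulmxA.
clearbody N.
have N0 i j : j <> w i -> N i j = 0.
  by move=> /eqP/negbTE ji; apply/eqP/negPn; rewrite Nw ji.
pose m (k : nat) : C := if insub k is Some j then N (w j) j else 1.
pose wn (k : nat) : nat := if insub k is Some j then w j else k.
have mE (j : 'I_n) : m j = N (w j) j by rewrite /m valK.
have wnE (j : 'I_n) : wn j = w j by rewrite /wn valK.
have wnK : involutive wn.
  move=> k; rewrite {2}/wn; case: insubP => [j _ <-|/negbTE kn].
    by rewrite wnE wK.
  by rewrite /wn insubF.
have m0 (j : 'I_n) : m j != 0 by rewrite mE Nw wK eqxx.
pose c := half_phase wn m.
have c0 (j : 'I_n) : c j != 0 by rewrite half_phase_neq0.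
pose D : 'rV[C]_n := \row_j (c j)^-1.
exists (T *m diag_mx D), w; split=> //.
- apply: triangularM => //; apply: triangular_diag_mx => // i.
  by rewrite mxE invr_eq0.
- move=> eN i wi; have := hN i i; rewrite /= eN mulN1r => /eqP.
  rewrite -addr_eq0 -mulr2n mulrn_eq0 /=; apply/negP.
  by rewrite Nw wi eqxx.
rewrite Ncongr tr_diag_mx => i j; rewrite mul_mx_diag mul_diag_mx !mxE.
split=> [ij|->].
  rewrite N0 ?mulr0 ?mul0r // => ji; apply: ij; by rewrite ji wK.
have -> : (c (w j))^-1 * N (w j) j / c j = m j / (c j * c (wn j)).
  by rewrite mE wnE; field; rewrite !c0.
have [->|->] := half_phaseM m j wnK; first by left; rewrite divff.
have -> : m j = eps * m (wn j) by rewrite wnE !mE wK hN.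
have mw0 : m (wn j) != 0 by rewrite wnE.
by rewrite mulfK.
Qed.

Lemma conjugation_signed_monomial M : M *m bar M = eps%:M ->
  exists T w, [/\ triangular r T, involutive w,
    eps = -1 -> forall i, w i <> i & signed_monomial w (invmx T *m M *m bar T)].
Proof.
move=> MM; have [T [w [tT wK wfree cT]]] := conjugation_monomial rI eps1 MM.
exists T, w; split=> // i j.
have -> : (invmx T *m M *m bar T) i j =
    (invmx T *m col j (M *m bar T)) i 0.
  by rewrite colE !mulmxA -colE !mxE.
have [s s1 ->] := cT j; rewrite -scalemxAr colE mulmxA mulVmx ?(proj1 tT) //.
rewrite mul1mx !mxE andbT; split=> [ij|->].
  by rewrite (negbTE (introN eqP ij)) mulr0.
by rewrite eqxx mulr1.
Qed.

End SignedReductions.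

(** * Existence of adapted unitary matrices *)

(** Conjugating [w] by a suitable transposition enlarges the set where it agrees
    with [io], and creates no fixed point. *)
Lemma fixfree_involutions_conjugate (T : finType) (io w : T -> T) :
  involutive io -> involutive w ->
  (forall x, io x <> x) -> (forall x, w x <> x) ->
  exists s : {perm T}, forall x, s (w x) = io (s x).
Proof.
move=> ioK wK io_ff w_ff; have [m] := ubnP #|[pred x | w x != io x]|.
elim: m w wK w_ff => // m IH w wK w_ff; rewrite ltnS => lem.
have [l /= wl|all] := pickP [pred x | w x != io x]; last first.
  by exists 1%g => x; rewrite !perm1; apply/eqP/negbFE; have := all x.
pose p := tperm (w l) (io l); pose w' x := p (w (p x)).
have w'K : involutive w' by move=> x; rewrite /w' !tpermK wK tpermK.
have w'_ff x : w' x <> x.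
  by rewrite /w' => /(congr1 p); rewrite tpermK; exact: w_ff.
have [|s sP] := IH w' w'K w'_ff.
  apply: leq_trans lem; apply: proper_card; apply/properP; split.
    apply/fintype.subsetP => x; rewrite !inE; apply: contraNneq => wx.
    have pfix y : w y = io y -> p y = y.
      move=> wy; apply: tpermD; apply/eqP => ye.
        by case/eqP: wl; rewrite ye -[LHS]ioK -wy -ye wK.
      by case/eqP: wl; rewrite ye -[l]ioK ye -wy wK.
    by rewrite /w' (pfix x wx) pfix ?wx // ioK -wx wK.
  exists l; rewrite !inE //= /w'.
  have -> : p l = l by apply: tpermD; apply/eqP; [exact: w_ff|exact: io_ff].
  by rewrite tpermL eqxx.
exists (p * s)%g => x; rewrite !permM -sP /w' tpermK.
by [].
Qed.

Section Existence.
Variables (R : realType) (n : nat).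
Local Notation C := R[i].
Local Notation cj := (@conjc R : {rmorphism C -> C}).
Local Notation bar := (map_mx conjc).
Local Notation unitary Q := ((bar Q)^T *m Q = 1%:M).
Implicit Types Om P Q M N : 'M[C]_n.

(** [(1 + i)/2 + (1 - i)/2 M] is a symmetric unitary square root of [M]. *)
Lemma symmetric_unitary_sqrt M : M^T = M -> bar M = M -> M *m M = 1%:M ->
  exists S, [/\ S^T = S, unitary S & S *m S = M].
Proof.
move=> Mt Mr MM; pose a : C := (1 + 'i%C) / 2%:R; pose b : C := (1 - 'i%C) / 2%:R.
have ii : 'i%C * 'i%C = -1 :> C by rewrite -expr2 sqr_i.
have iJ : ('i%C : C)^*%C = - 'i%C by apply/eqP; rewrite eq_complex /= oppr0 !eqxx.
have aJ : a^*%C = b.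
  have -> : a^*%C = (1^*%C + 'i^*%C) / 2%:R^*%C.
    by rewrite -(rmorphD cj) -(fmorph_div cj).
  by rewrite conjc1 conjc_nat iJ.
have bJ : b^*%C = a by rewrite -aJ conjcK.
have ab : a * b = 2%:R^-1.
  have -> : a * b = (1 - 'i%C * 'i%C) / 4%:R by rewrite /a /b; field.
  by rewrite ii; field.
have aa : a * a + b * b = 0.
  have -> : a * a + b * b = (1 + 'i%C * 'i%C) / 2%:R by rewrite /a /b; field.
  by rewrite ii subrr mul0r.
have mulE x y z u : (x%:M + y *: M) *m (z%:M + u *: M) =
    (x * z + y * u)%:M + (x * u + y * z) *: M.
  rewrite mulmxDl !mulmxDr -scalar_mxM !mul_scalar_mx -!scalemxAl mul_mx_scalar.
  rewrite -scalemxAr MM !scalerA scalemx1 [in RHS]raddfD /= scalerDl.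
  by rewrite [_ *: M + (y * u)%:M]addrC addrACA.
pose S := a%:M + b *: M.
have St : S^T = S by rewrite linearD /= tr_scalar_mx linearZ /= Mt.
exists S; split=> //.
  have -> : bar S = b%:M + a *: M.
    by rewrite map_mxD map_scalar_mx map_mxZ Mr; congr (_%:M + _ *: _).
  have -> : (b%:M + a *: M)^T = b%:M + a *: M.
    by rewrite linearD /= tr_scalar_mx linearZ /= Mt.
  rewrite mulE [b * a]mulrC [b * b + _]addrC aa scale0r addr0 ab.
  by congr (_ %:M); field.
rewrite mulE aa raddf0 add0r [b * a]mulrC ab -[RHS]scale1r.
by congr (_ *: _); field.
Qed.

Lemma bar_conjugate Om Q : bar Om = Om -> unitary Q ->
  bar (invmx Q *m Om *m bar Q) = Q^T *m Om *m Q.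
Proof. by move=> Omr uQ; rewrite unitaryV // !map_mxM Omr map_trmx !barK. Qed.

(** When [Om] is a permutation matrix, symmetric unitary square roots [S] of [Om]
    and [Z] of the matrix of [w] give the solution [S *m bar Z]. In the absence of
    fixed points, a permutation that conjugates [w] to [io] is a solution. *)
Lemma exists_signed_unitary (io w : 'I_n -> 'I_n) Om :
  involutive io -> involutive w -> signed_monomial io Om ->
  (forall i j, Om i j = (i == io j)%:R) \/
  ((forall i, io i <> i) /\ (forall i, w i <> i)) ->
  exists2 Q, unitary Q & signed_monomial w (invmx Q *m Om *m bar Q).
Proof.
move=> ioK wK sOm [OmE|[io_ff w_ff]].
  pose W : 'M[C]_n := \matrix_(i, j) (i == w j)%:R.
  have inv (v : 'I_n -> 'I_n) N : involutive v ->
      (forall i j, N i j = (i == v j)%:R :> C) ->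
      [/\ N^T = N, bar N = N & N *m N = 1%:M].
    move=> vK NE; split; apply/matrixP => i j; rewrite !mxE ?NE.
    - by rewrite -(inj_eq (can_inj vK)) vK eq_sym.
    - exact: conjc_nat.
    rewrite (bigD1 (v j)) //= big1 ?addr0 => [|k kj].
      by rewrite !NE vK eqxx mulr1.
    by rewrite !NE (negbTE kj) mulr0.
  have [Ot Or OO] := inv io Om ioK OmE.
  have [Wt Wr WW] : [/\ W^T = W, bar W = W & W *m W = 1%:M].
    by apply: (inv w) => // i j; rewrite mxE.
  have [S [St uS SS]] := symmetric_unitary_sqrt Ot Or OO.
  have [Z [Zt uZ ZZ]] := symmetric_unitary_sqrt Wt Wr WW.
  have Sb : (bar S)^T = bar S by rewrite map_trmx St.
  have Zb : (bar Z)^T = bar Z by rewrite map_trmx Zt.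
  have uZ' : unitary (bar Z) by rewrite barK Zt; apply: mulmx1C; rewrite -Zb.
  have uQ := unitaryM uS uZ'; exists (S *m bar Z) => //.
  have -> : invmx (S *m bar Z) *m Om *m bar (S *m bar Z) = W.
    rewrite (unitaryV uQ) map_mxM barK trmx_mul Zt Sb.
    rewrite Sb in uS; have uS' := mulmx1C uS.
    rewrite -SS !mulmxA -(mulmxA Z) uS mulmx1.
    by rewrite -(mulmxA Z) uS' mulmx1 ZZ.
  move=> i j; rewrite mxE; split=> [/eqP/negbTE ->|->] //.
  by left; rewrite eqxx.
have [s sP] := fixfree_involutions_conjugate ioK wK io_ff w_ff.
pose Q : 'M[C]_n := \matrix_(i, j) (i == s j)%:R.
have Qr : bar Q = Q by apply/matrixP => i j; rewrite !mxE; exact: conjc_nat.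
have mulQ M i j : (M *m Q) i j = M i (s j).
  rewrite mxE (bigD1 (s j)) //= big1 ?addr0 => [|k kj].
    by rewrite mxE eqxx mulr1.
  by rewrite mxE (negbTE kj) mulr0.
have mulQt M i j : (Q^T *m M) i j = M (s i) j.
  by rewrite -[M]trmxK -trmx_mul mxE mulQ !mxE.
have uQ : unitary Q.
  rewrite Qr; apply/matrixP => i j; rewrite mulQt !mxE.
  by rewrite (inj_eq perm_inj).
exists Q => //; rewrite unitaryV // Qr => i j; rewrite mulQ mulQt.
split=> [ij|->]; last by apply: (proj2 (sOm _ _)); rewrite sP.
by apply: (proj1 (sOm _ _)); rewrite -sP => /perm_inj.
Qed.

End Existence.

(** * The involution attached to the form *)

Section Omega.
Variables (R : realType) (t : typeA) (Om : nat -> nat -> R[i]).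

Definition sign_of : R[i] := if t is A1 then 1 else -1.

(** What is used of the block structure: [io] is the involution exchanging the
    two indices of each block of size 2, and arbitrarily long initial segments are
    unions of blocks. *)
Record Omega_pairing (io : nat -> nat) : Prop := {
  pairing_invol : involutive io;
  pairing_zero : forall k l, l <> io k -> Om k l = 0;
  pairing_unit : forall k, Om k (io k) = 1 \/ Om k (io k) = -1;
  pairing_one : t = A1 -> forall k, Om k (io k) = 1;
  pairing_free : t = A2 -> forall k, io k <> k;
  pairing_sym : forall k l, Om l k = sign_of * Om k l;
  pairing_cofinal : forall N, exists2 n, (N <= n)%N &
    forall k, (io k < n)%N = (k < n)%N }.

Lemma Omega_pairing_exists : is_Omega t Om -> exists io, Omega_pairing io.
Proof.
move=> [s [sA2 OmE Omsupp]].
have startS n : block_start s n.+1 = (block_start s n + (s n).+1)%N.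
  by rewrite /block_start big_ord_recr.
have start_ge n : (n <= block_start s n)%N.
  by elim: n => // n IH; rewrite startS; lia.
have start_mono m n : (m <= n)%N -> (block_start s m <= block_start s n)%N.
  move=> /subnKC <-; elim: (n - m)%N => [|p IH]; first by rewrite addn0.
  by rewrite addnS startS; lia.
have block k : exists n, (block_start s n <= k < block_start s n.+1)%N.
  elim: k => [|k [n kn]]; first by exists 0%N; rewrite startS /block_start big_ord0.
  have [kn'|kn'] := ltnP k.+1 (block_start s n.+1).
    by exists n; lia.
  by exists n.+1; have := startS n.+1; lia.
have block_unique k m n : (block_start s m <= k < block_start s m.+1)%N ->
    (block_start s n <= k < block_start s n.+1)%N -> m = n.
  move=> km kn; have [mn|nm|//] := ltngtP m n.
    by have := start_mono _ _ mn; lia.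
  by have := start_mono _ _ nm; lia.
have partner k : exists m, [/\ forall l, l <> m -> Om k l = 0,
    (Om k m = 1 \/ Om k m = -1) /\ (t = A1 -> Om k m = 1),
    t = A2 -> m <> k, Om m k = sign_of * Om k m
    & forall N, (m < block_start s N)%N = (k < block_start s N)%N].
  have [n kn] := block k.
  have supp l : Om k l != 0 -> (block_start s n <= l < block_start s n.+1)%N.
    by move=> /Omsupp[m [km lm]]; rewrite (block_unique _ _ _ kn km).
  have same m : (block_start s n <= m < block_start s n.+1)%N ->
      forall N, (m < block_start s N)%N = (k < block_start s N)%N.
    move=> mn N; have [nN|nN] := ltnP n N.
      by have := start_mono _ _ nN; lia.
    by have := start_mono _ _ nN; lia.
  move: (sA2) (OmE n) same supp kn; rewrite startS => {}sA2.
  have {}sA2 : t = A2 -> s n by move=> /sA2.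
  move: (block_start s n) (s n) sA2 => st [] sA2 H same supp kn; last first.
    have tE : t = A1 by case: t sA2 => // /(_ erefl).
    have kE : k = st by lia.
    have Okk : Om k k = 1.
      by have := H ord0 ord0; rewrite /= addn0 -kE mxE eqxx.
    exists k; split=> [l lk|||//|//].
    - by apply/eqP/negPn/negP => /supp; lia.
    - by rewrite Okk; split; [left|].
    - by rewrite tE.
    - by rewrite /sign_of tE mul1r.
  have H2 i j (ib : (i < 2)%N) (jb : (j < 2)%N) : Om (st + i)%N (st + j)%N =
      if i == j then 0 else if t is A2 then (if (i < j)%N then 1 else -1) else 1.
    by have := H (Ordinal ib) (Ordinal jb); rewrite /= mxE.
  have [kE|kE] : k = (st + 0)%N \/ k = (st + 1)%N by lia.
  - exists (st + 1)%N; rewrite kE !H2 //=; split.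
    + move=> l lm; apply/eqP/negPn/negP => h.
      have lE : l = (st + 0)%N by move: (h); rewrite -kE => /supp; lia.
      by move: h; rewrite lE H2 //= eqxx.
    + by case: t; split=> //; left.
    + by move=> _; lia.
    + by rewrite /sign_of; case: t; rewrite mulr1.
    + by rewrite -kE; apply: same; lia.
  - exists (st + 0)%N; rewrite kE !H2 //=; split.
    + move=> l lm; apply/eqP/negPn/negP => h.
      have lE : l = (st + 1)%N by move: (h); rewrite -kE => /supp; lia.
      by move: h; rewrite lE H2 //= eqxx.
    + by case: t; split=> //; [left|right].
    + by move=> _; lia.
    + by rewrite /sign_of; case: t; rewrite ?mulr1 // mulrNN mulr1.
    + by rewrite -kE; apply: same; lia.
have [io ioP] := choice partner.
have unit k : Om k (io k) != 0.
  by case: (ioP k) => _ [[]-> _] _ _ _; rewrite ?oppr_eq0 oner_eq0.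
have sgn0 : sign_of != 0.
  by rewrite /sign_of; case: t; rewrite ?oppr_eq0 oner_eq0.
have ioK : involutive io.
  move=> k; apply: contrapT => nk; case: (ioP (io k)) => z _ _ _ _.
  have := z k (fun e => nk (esym e)); case: (ioP k) => _ _ _ -> _ /eqP.
  by rewrite mulf_eq0 (negbTE sgn0) (negbTE (unit k)).
exists io; split=> //.
- by move=> k l; case: (ioP k) => + _ _ _ _; apply.
- by move=> k; case: (ioP k) => _ [].
- by move=> tE k; case: (ioP k) => _ [_ h] _ _ _; exact: h.
- by move=> tE k; case: (ioP k) => _ _ h _ _; exact: h.
- move=> k l; have [->|lk] := eqVneq l (io k); first by case: (ioP k).
  have -> : Om k l = 0 by case: (ioP k) => h _ _ _ _; apply: h; exact/eqP.
  rewrite mulr0; case: (ioP l) => h _ _ _ _; apply: h => kl.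
  by case/eqP: lk; rewrite kl ioK.
- by move=> N; exists (block_start s N) => // k; case: (ioP k).
Qed.

End Omega.

(** * Flags and their relative position *)

Section Flags.
Variables (R : realType) (V : lmodType R[i]).
Implicit Types (v u : nat -> V) (x y : V) (D : set nat).

Definition coord_span v D : set V :=
  [set x | forall l, ~ D l -> coord v x l = 0].

Definition down_set (d : Order.disp_t) (B : orderType d) (tau : nat -> B) :
    set (set nat) :=
  [set D | exists b, D = [set l | (tau l < b)%O] \/ D = [set l | (tau l <= b)%O]].

Lemma flagE (d : Order.disp_t) (B : orderType d) (tau : nat -> B) v :
  is_basis v -> flag tau v = [set coord_span v D | D in down_set tau].
Proof.
move=> bv; apply/seteqP; split=> [F [b [->|->]]|_ [D [b bD] <-]].
- by exists [set l | (tau l < b)%O]; [exists b; left|rewrite span_basisE].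
- by exists [set l | (tau l <= b)%O]; [exists b; right|rewrite span_basisE].
by exists b; case: bD => ->; [left|right]; rewrite span_basisE.
Qed.

Lemma flag_reindex (d : Order.disp_t) (B : orderType d) (tau : nat -> B) v
    (p q : nat -> nat) : cancel q p -> flag (tau \o p) (v \o p) = flag tau v.
Proof.
move=> pK.
have E (P : B -> Prop) :
    (v \o p) @` [set l | P (tau (p l))] = v @` [set l | P (tau l)].
  apply/seteqP; split=> _ [l /= Pl <-]; first by exists (p l).
  by exists (q l) => /=; rewrite pK.
by apply/seteqP; split=> F [b bF]; exists b; move: bF;
  rewrite /= (E (fun a => (a < b)%O)) (E (fun a => (a <= b)%O)).
Qed.

Lemma basis_reindex v (p q : nat -> nat) : is_basis v -> cancel p q ->
  cancel q p ->
  is_basis (v \o p) /\ forall x l, coord (v \o p) x l = coord v x (p l).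
Proof.
move=> bv pK qK.
have qb : bijective q by exists p.
have pb : bijective p by exists q.
have co x : is_coord (v \o p) x (coord v x \o p).
  have [fx xE] := coordP bv x; split.
    rewrite (_ : [set l | _] = q @` [set l | coord v x l != 0]).
      exact: finite_image.
    apply/seteqP; split=> [l /= h|_ [l /= h <-]]; first by exists (p l).
    by rewrite qK.
  by rewrite {1}xE (@reindex_fsbigT _ _ _ _ _ p _ pb).
have un x c : is_coord (v \o p) x c -> c = coord v x \o p.
  move=> [fc xE]; apply/funext => l /=.
  have -> : coord v x = c \o q; last by rewrite /= pK.
  apply: coord_unique => //; split.
    rewrite (_ : [set l | _] = p @` [set l | c l != 0]).
      exact: finite_image.
    apply/seteqP; split=> [k /= h|_ [k /= h <-]]; last by rewrite pK.
    by exists (q k).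
  rewrite xE (@reindex_fsbigT _ _ _ _ _ q _ qb).
  by apply: eq_fsbigr => k _ /=; rewrite qK.
have bvp : is_basis (v \o p).
  by move=> x; exists (coord v x \o p); split=> // c /un ->.
split=> // x l; have := un x _ (coordP bvp x) => ->.
by [].
Qed.

Section TwoBases.
Variables (v v' : nat -> V).
Hypotheses (bv : is_basis v) (bv' : is_basis v').
Hypothesis vv' : exists N, forall l, (N <= l)%N -> v l = v' l.

(** The transition matrix between two bases that agree almost everywhere is
    invertible, so some term of the expansion of its determinant is nonzero. *)
Lemma basis_matching : exists s : nat -> nat, [/\ injective s,
  exists N, forall l, (N <= l)%N -> s l = l & forall l, coord v (v' l) (s l) != 0].
Proof.
have [N0 eqN] := vv'.
have bound (a b : nat -> V) : is_basis a ->
    exists N, forall l k, (l < N0)%N -> (N <= k)%N -> coord a (b l) k = 0.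
  move=> ba; have [M MP] := choice (fun l => coord_bound ba (b l)).
  exists (\max_(l < N0) M l) => l k lN kM; apply: MP; apply: leq_trans kM.
  exact: (leq_bigmax (Ordinal lN)).
have [N1 b1] := bound v v' bv; have [N2 b2] := bound v' v bv'.
pose N := maxn N0 (maxn N1 N2).
have bnd (a b : nat -> V) Na : is_basis a -> (Na <= N)%N ->
    (forall l, (N0 <= l)%N -> a l = b l) ->
    (forall l k, (l < N0)%N -> (Na <= k)%N -> coord a (b l) k = 0) ->
    forall l k, (l < N)%N -> (N <= k)%N -> coord a (b l) k = 0.
  move=> ba NaN eqab bab l k lN kN; have [lN0|lN0] := ltnP l N0.
    by apply: bab => //; exact: leq_trans kN.
  by rewrite -eqab // coord_basis // gtn_eqF // (leq_trans lN).
have b1' := bnd v v' N1 bv _ eqN b1.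
have b2' := bnd v' v N2 bv' _ (fun l h => esym (eqN l h)) b2.
have {}b1' : forall l k, (l < N)%N -> (N <= k)%N -> coord v (v' l) k = 0.
  by apply: b1'; rewrite /N leq_max leq_maxl orbT.
have {}b2' : forall l k, (l < N)%N -> (N <= k)%N -> coord v' (v l) k = 0.
  by apply: b2'; rewrite /N !leq_max leqnn !orbT.
pose T : 'M_N := \matrix_(i, j) coord v (v' j) i.
pose T' : 'M_N := \matrix_(i, j) coord v' (v j) i.
have TT' : T *m T' = 1%:M.
  apply/matrixP => i j; rewrite mxE [RHS]mxE.
  rewrite -[(i == j)]/(val i == val j) -(coord_basis bv).
  rewrite (@coord_expand _ _ _ bv' (v j) N) => [|k]; last exact: b2'.
  rewrite coord_sum //; apply: eq_bigr => k _.
  by rewrite !mxE coordZ // mulrC.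
have [/unitmx_perm[s sT] _] := mulmx1_unit TT'.
pose s' (l : nat) : nat := if insub l is Some i then s i else l.
have s'E (i : 'I_N) : s' i = s i by rewrite /s' valK.
have s'N l : (N <= l)%N -> s' l = l by move=> lN; rewrite /s' insubF // ltnNge lN.
exists s'; split.
- move=> k l; have [kN|kN] := ltnP k N; have [lN|lN] := ltnP l N.
  + rewrite (s'E (Ordinal kN)) (s'E (Ordinal lN)) => /val_inj/perm_inj.
    by move/(congr1 val).
  + rewrite (s'E (Ordinal kN)) (s'N l) // => h.
    by move: lN; rewrite -h leqNgt ltn_ord.
  + rewrite (s'E (Ordinal lN)) (s'N k) // => h.
    by move: kN; rewrite h leqNgt ltn_ord.
  + by rewrite !s'N.
- by exists N.
move=> l; have [lN|lN] := ltnP l N.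
  by have := sT (Ordinal lN); rewrite (s'E (Ordinal lN)) mxE.
rewrite s'N // -eqN ?coord_basis ?eqxx ?oner_eq0 //.
by apply: leq_trans lN; rewrite leq_max leqnn.
Qed.

Lemma coord_span_basis u D l : is_basis u -> D l -> coord_span u D (u l).
Proof.
move=> bu Dl k nDk; rewrite coord_basis //; case: eqP => // kl.
by rewrite kl in nDk.
Qed.

(** The matching sends [D'] into [D] and is periodic, so [D'] cannot be larger:
    bases that agree almost everywhere have relative dimension zero. *)
Lemma coord_span_rigid D D' : D `<=` D' ->
  coord_span v' D' `<=` coord_span v D -> D = D'.
Proof.
move=> DD' sub; apply/seteqP; split=> // l D'l.
have [s [sI sN sc]] := basis_matching.
have step k : D' k -> D (s k).
  move=> D'k; apply: contrapT => /(sub _ (coord_span_basis bv' D'k)) z.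
  by have := sc k; rewrite z eqxx.
have [m sm] := periodic_nat sI sN l.
rewrite -sm /=; apply: (step); elim: m {sm} => // m IH /=.
by apply: DD'; exact: step.
Qed.

End TwoBases.

Lemma down_set_total (d : Order.disp_t) (B : orderType d) (tau : nat -> B) D D' :
  down_set tau D -> down_set tau D' -> D `<=` D' \/ D' `<=` D.
Proof.
have lt_imp (b c : B) : (b < c)%O -> forall D D',
    (D = [set l | (tau l < b)%O] \/ D = [set l | (tau l <= b)%O]) ->
    (D' = [set l | (tau l < c)%O] \/ D' = [set l | (tau l <= c)%O]) ->
    D `<=` D'.
  move=> bc {}D {}D' [] -> [] -> l /= h.
  - exact: lt_trans h bc.
  - exact: ltW (lt_trans h bc).
  - exact: le_lt_trans h bc.
  - exact: le_trans h (ltW bc).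
move=> [b bD] [c cD']; case: (ltgtP b c) => [bc|cb|bc].
- by left; exact: (lt_imp _ _ bc).
- by right; exact: (lt_imp _ _ cb).
rewrite -bc in cD'; move: bD cD' => [] -> [] ->; try by left.
- by left=> l /= /ltW.
- by right=> l /= /ltW.
Qed.

(** A flag is a set of subspaces without indices; rigidity recovers them. *)
Lemma flag_eq_span (d : Order.disp_t) (B : orderType d) (tau : nat -> B) v v' :
  is_basis v -> is_basis v' -> (exists N, forall l, (N <= l)%N -> v l = v' l) ->
  flag tau v = flag tau v' ->
  forall D, down_set tau D -> coord_span v D = coord_span v' D.
Proof.
move=> bv bv' vv' fE D dD.
have v'v : exists N, forall l, (N <= l)%N -> v' l = v l.
  by have [N NP] := vv'; exists N => l /NP.
have : flag tau v (coord_span v D) by rewrite flagE //; exists D.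
rewrite fE flagE // => -[D' dD' DE]; rewrite -DE.
have [DD'|D'D] := down_set_total dD dD'.
  by rewrite (coord_span_rigid bv bv' vv' DD') // DE.
by rewrite (coord_span_rigid bv' bv v'v D'D) // DE.
Qed.

Lemma flag_eq_coord (d : Order.disp_t) (B : orderType d) (tau : nat -> B) v v' :
  is_basis v -> is_basis v' -> (exists N, forall l, (N <= l)%N -> v l = v' l) ->
  flag tau v = flag tau v' ->
  forall k l, coord v (v' l) k != 0 -> (tau k <= tau l)%O.
Proof.
move=> bv bv' vv' fE k l; apply: contra_neqT => kl.
have : coord_span v' [set m | (tau m <= tau l)%O] (v' l).
  by apply: coord_span_basis => /=.
rewrite -(flag_eq_span bv bv' vv' fE); last by exists (tau l); right.
by apply => /= h; rewrite h in kl.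
Qed.

Lemma triangular_flag (d : Order.disp_t) (B : orderType d) (tau : nat -> B) v v' :
  is_basis v -> is_basis v' ->
  (forall k l, coord v (v' l) k != 0 -> (tau k <= tau l)%O) ->
  (forall k l, coord v' (v l) k != 0 -> (tau k <= tau l)%O) ->
  flag tau v = flag tau v'.
Proof.
move=> bv bv' t t'; rewrite !flagE //.
have sub u u' : is_basis u -> is_basis u' ->
    (forall k l, coord u (u' l) k != 0 -> (tau k <= tau l)%O) ->
    forall D, down_set tau D -> coord_span u' D `<=` coord_span u D.
  move=> bu bu' tu D dD x xD l nDl.
  have [N x0] := coord_bound bu' x; rewrite (coord_expand bu' x0) coord_sum //.
  apply: big1 => k _; rewrite coordZ //.
  have [Dk|/xD ->] := pselect (D k); last by rewrite mul0r.
  have [->|/tu lk] := eqVneq (coord u (u' k) l) 0; first by rewrite mulr0.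
  case: nDl; case: dD Dk => b [] -> /=; first exact: le_lt_trans.
  exact: le_trans.
by apply: eq_imagel => D dD; apply/seteqP; split; exact: sub.
Qed.

(** The transition matrix is triangular for the first order, so its diagonal does
    not vanish. Being also triangular for the second order along [w] and [w'], it
    forces [tau2 (w (w' l)) <= tau2 l], and [w \o w'] moves finitely many
    indices. *)
Lemma relative_position (d1 d2 : Order.disp_t) (B1 : orderType d1)
    (B2 : orderType d2) (tau1 : nat -> B1) (tau2 : nat -> B2) v v'
    (w w' : nat -> nat) :
  injective tau1 -> injective tau2 -> is_basis v -> is_basis v' ->
  (exists N, forall l, (N <= l)%N -> v l = v' l) ->
  involutive w -> involutive w' ->
  (exists N, forall l, (N <= l)%N -> w l = w' l) ->
  flag tau1 v = flag tau1 v' -> flag tau2 (v \o w) = flag tau2 (v' \o w') ->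
  w = w'.
Proof.
move=> t1I t2I bv bv' vv' wK w'K [Nw ww'] f1 f2.
have [s [sI sN sc]] := basis_matching bv bv' vv'.
have sid := periodic_decreasing t1I (periodic_nat sI sN)
  (fun l => flag_eq_coord bv bv' vv' f1 (sc l)).
have diag l : coord v (v' l) l != 0 by have := sc l; rewrite sid.
have [bvw cvw] := basis_reindex bv wK wK.
have [bvw' _] := basis_reindex bv' w'K w'K.
have vw : exists N, forall l, (N <= l)%N -> (v \o w) l = (v' \o w') l.
  have [N vN] := vv'; exists (maxn N Nw + \max_(l < N) w l).+1 => l lN /=.
  have /ww' <- : (Nw <= l)%N
    by rewrite (leq_trans _ (ltnW lN)) // (leq_trans (leq_maxr N _)) // leq_addr.
  apply: vN; rewrite leqNgt; apply/negP => wlN.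
  have h : (w (w l) <= \max_(i < N) w i)%N.
    exact: (leq_bigmax (F := fun i : 'I_N => w i) (Ordinal wlN)).
  rewrite wK in h.
  by move: lN; rewrite ltnNge (leq_trans h) // leq_addl.
have dec l : (tau2 (w (w' l)) <= tau2 l)%O.
  apply: (flag_eq_coord bvw bvw' vw f2); rewrite cvw /= wK.
  exact: diag.
have pI : injective (w \o w') by exact: inj_comp (can_inj wK) (can_inj w'K).
have pN : exists N, forall l, (N <= l)%N -> (w \o w') l = l.
  by exists Nw => l /ww' /= <-; rewrite wK.
have pid := periodic_decreasing t2I (periodic_nat pI pN) dec.
by apply/funext => l; rewrite -{1}[l]pid /= wK.
Qed.

End Flags.

(** * The bilinear form and the conjugation *)

Section Forms.
Variables (R : realType) (V : lmodType R[i]) (e : nat -> V) (be : is_basis e).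
Variables (t : typeA) (Om : nat -> nat -> R[i]) (io : nat -> nat).
Hypothesis pairing : Omega_pairing t Om io.
Local Notation C := R[i].
Local Notation cj := (@conjc R : {rmorphism C -> C}).
Local Notation bar := (map_mx conjc).
Local Notation eps := (sign_of R t).
Local Notation omega := (omega e Om).
Local Notation gamma := (gamma e Om).
Implicit Types (x y z : V) (v : nat -> V).

Let ioK := pairing_invol pairing.

Lemma Om_unit_neq0 k : Om k (io k) != 0.
Proof. by case: (pairing_unit pairing k) => ->; rewrite ?oppr_eq0 oner_eq0. Qed.

Lemma Om_neq0 k l : (Om k l != 0) = (l == io k).
Proof.
have [->|/eqP lk] := eqVneq l (io k); first exact: Om_unit_neq0.
by rewrite (pairing_zero pairing lk) eqxx.
Qed.

Lemma Om_conj k l : (Om k l)^*%C = Om k l.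
Proof.
have [->|/eqP lk] := eqVneq l (io k); last first.
  by rewrite (pairing_zero pairing lk) conjc0.
by case: (pairing_unit pairing k) => ->; [exact: conjc1|exact: (rmorphN1 cj)].
Qed.

Lemma Om_io_sqr k : Om k (io k) * Om k (io k) = 1.
Proof. by case: (pairing_unit pairing k) => ->; rewrite ?mulrNN mulr1. Qed.

Lemma Om_io k : Om (io k) k = eps * Om k (io k).
Proof. exact: (pairing_sym pairing). Qed.

Lemma eps_sqr : eps * eps = 1.
Proof. by rewrite /sign_of; case: t; rewrite ?mulrNN mulr1. Qed.

Lemma fsum_Om k (f : nat -> C) :
  \sum_(l \in [set: nat]) Om k l * f l = Om k (io k) * f (io k).
Proof.
have <- : \sum_(l \in [set io k]) Om k l * f l = Om k (io k) * f (io k).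
  by rewrite fsbig_set1.
apply/esym/fsbig_widen => // l [_ /= lk].
by rewrite (pairing_zero pairing lk) mul0r.
Qed.

Lemma stable_bound x : exists2 n, (forall k, (io k < n)%N = (k < n)%N) &
  forall l, (n <= l)%N -> coord e x l = 0.
Proof.
have [N xN] := coord_bound be x; have [n Nn nP] := pairing_cofinal pairing N.
by exists n => // l nl; apply: xN; exact: leq_trans nl.
Qed.

Lemma gammaE x k :
  coord e (gamma x) k = Om k (io k) * (coord e x (io k))^*%C.
Proof.
have [n nP xn] := stable_bound x.
pose c k := Om k (io k) * (coord e x (io k))^*%C.
have cn l : (n <= l)%N -> c l = 0.
  by move=> nl; rewrite /c xn ?conjc0 ?mulr0 // leqNgt nP -leqNgt.
have -> : gamma x = \sum_(k < n) c k *: e k.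
  rewrite -(@fsum_ord _ (fun k => c k *: e k)) => [|l /cn ->]; last exact: scale0r.
  by apply: eq_fsbigr => l _; rewrite fsum_Om.
by rewrite coord_of_sum //; case: ltnP => // /cn.
Qed.

Lemma omegaE x y N : (forall l, (N <= l)%N -> coord e x l = 0) -> omega x y =
  \sum_(k < N) coord e x k * (Om k (io k) * coord e y (io k)).
Proof.
move=> xN; rewrite /Defs.omega (@fsum_ord _ _ N) => [|l lN]; last first.
  by apply: fsbig1 => k _; rewrite xN // !mul0r.
apply: eq_bigr => k _; rewrite -fsum_Om mulr_fsumr.
by apply: eq_fsbigr => l _; rewrite mulrA.
Qed.

Lemma gamma_semilinear a x y : gamma (a *: x + y) = a^*%C *: gamma x + gamma y.
Proof.
apply: (coord_inj be); apply/funext => k.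
rewrite coord_lin // !gammaE coord_lin // (rmorphD cj) (rmorphM cj) /=.
by rewrite mulrDr mulrCA.
Qed.

Lemma gamma0 : gamma 0 = 0.
Proof.
by apply: (coord_inj be); apply/funext => k; rewrite gammaE !coord0 // conjc0 mulr0.
Qed.

Lemma gammaZ a x : gamma (a *: x) = a^*%C *: gamma x.
Proof. by rewrite -[a *: x]addr0 gamma_semilinear gamma0 addr0. Qed.

Lemma gammaD x y : gamma (x + y) = gamma x + gamma y.
Proof. by rewrite -[x]scale1r gamma_semilinear conjc1 !scale1r. Qed.

Lemma gamma_sum (I : Type) (r : seq I) (F : I -> V) :
  gamma (\sum_(i <- r) F i) = \sum_(i <- r) gamma (F i).
Proof.
by elim/big_rec2: _ => [|i y x _ <-]; [exact: gamma0|exact: gammaD].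
Qed.

Lemma gammaK x : gamma (gamma x) = eps *: x.
Proof.
apply: (coord_inj be); apply/funext => k.
rewrite coordZ // !gammaE ioK (rmorphM cj) /= conjcK Om_conj Om_io.
by rewrite mulrA [_ * (eps * _)]mulrCA Om_io_sqr mulr1.
Qed.

Lemma omega_linear_l a x y z : omega (a *: x + y) z = a * omega x z + omega y z.
Proof.
have [N xN] := coord_bound be x; have [M yM] := coord_bound be y.
have xK l : (maxn N M <= l)%N -> coord e x l = 0.
  by rewrite geq_max => /andP[/xN].
have yK l : (maxn N M <= l)%N -> coord e y l = 0.
  by rewrite geq_max => /andP[_ /yM].
rewrite (omegaE _ xK) (omegaE _ yK) (@omegaE _ _ (maxn N M)) => [|l lK].
  rewrite mulr_sumr -big_split; apply: eq_bigr => k _ /=.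
  by rewrite coord_lin // mulrDl -mulrA.
by rewrite coord_lin // xK // yK // mulr0 addr0.
Qed.

Lemma omega_linear_r a x y z : omega z (a *: x + y) = a * omega z x + omega z y.
Proof.
have [N zN] := coord_bound be z; rewrite !(omegaE _ zN) mulr_sumr -big_split.
by apply: eq_bigr => k _ /=; rewrite coord_lin //; ring.
Qed.

Lemma omega0l z : omega 0 z = 0.
Proof. by rewrite (@omegaE _ _ 0) ?big_ord0 // => l _; rewrite coord0. Qed.

Lemma omega0r z : omega z 0 = 0.
Proof. by have := omega_linear_r (-1) 0 0 z; rewrite scaler0 addr0 mulN1r addNr. Qed.

Lemma omegaZl a x z : omega (a *: x) z = a * omega x z.
Proof. by rewrite -[a *: x]addr0 omega_linear_l omega0l addr0. Qed.

Lemma omegaZr a x z : omega z (a *: x) = a * omega z x.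
Proof. by rewrite -[a *: x]addr0 omega_linear_r omega0r addr0. Qed.

Lemma omega_suml (I : Type) (r : seq I) (F : I -> V) z :
  omega (\sum_(i <- r) F i) z = \sum_(i <- r) omega (F i) z.
Proof.
elim/big_rec2: _ => [|i y x _ <-]; first exact: omega0l.
by rewrite -[F i]scale1r omega_linear_l mul1r scale1r.
Qed.

Lemma omega_sumr (I : Type) (r : seq I) (F : I -> V) z :
  omega z (\sum_(i <- r) F i) = \sum_(i <- r) omega z (F i).
Proof.
elim/big_rec2: _ => [|i y x _ <-]; first exact: omega0r.
by rewrite -[F i]scale1r omega_linear_r mul1r scale1r.
Qed.

Lemma omega_basis k l : omega (e k) (e l) = Om k l.
Proof.
rewrite (@omegaE _ _ k.+1) => [|j kj]; last by rewrite coord_basis // gtn_eqF.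
rewrite (bigD1 ord_max) //= big1 ?addr0 => [|j jk]; last first.
  by move: jk; rewrite -val_eqE coord_basis //= => /negbTE ->; rewrite mul0r.
rewrite !coord_basis // eqxx mul1r; case: (io k =P l) => [<-|lk].
  by rewrite mulr1.
by rewrite mulr0 (pairing_zero pairing) // => lE; case: lk.
Qed.

Lemma iota_starE : iota_star e Om = io.
Proof.
have single l m : Defs.omega e Om (e l) (e m) != 0 -> m = io l.
  by rewrite omega_basis Om_neq0 => /eqP.
apply/funext => l; apply: single;
apply: (@xgetPex _ 0%N [set m | Defs.omega e Om (e l) (e m) != 0]).
by exists (io l); rewrite /= omega_basis; exact: Om_unit_neq0.
Qed.

(** [omega (gamma x) y] is the standard positive definite hermitian form. *)
Lemma omega_gamma x N : (forall l, (N <= l)%N -> coord e x l = 0) ->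
  omega (gamma x) x = \sum_(k < N) coord e x k * (coord e x k)^*%C.
Proof.
have gen n : (forall k, (io k < n)%N = (k < n)%N) ->
    (forall l, (n <= l)%N -> coord e x l = 0) ->
    omega (gamma x) x = \sum_(k < n) coord e x k * (coord e x k)^*%C.
  move=> nP xn; rewrite (@omegaE _ _ n) => [|l nl]; last first.
    by rewrite gammaE xn ?conjc0 ?mulr0 // leqNgt nP -leqNgt.
  have lt (i : 'I_n) : (io i < n)%N by rewrite nP.
  rewrite (reindex_inj (h := fun i : 'I_n => Ordinal (lt i))) /=; last first.
    by move=> i j [/(can_inj ioK)/val_inj].
  apply: eq_bigr => i _; have Oi := Om_io_sqr (io i); rewrite ioK in Oi.
  by rewrite gammaE ioK mulrACA Oi mul1r mulrC.
move=> xN; have [n nP xn] := stable_bound x; rewrite (gen n) //.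
rewrite -!(@fsum_ord _ (fun k => coord e x k * (coord e x k)^*%C)) //.
  by move=> l /xN ->; rewrite mul0r.
by move=> l /xn ->; rewrite mul0r.
Qed.

End Forms.

(** * Bases that agree almost everywhere with a given one *)

Section Frames.
Variables (R : realType) (V : lmodType R[i]) (e : nat -> V) (be : is_basis e).
Local Notation C := R[i].

Section FixedSize.
Variable n : nat.
Implicit Types P Q T : 'M[C]_n.

(** Bases that agree almost everywhere with [e] are encoded by invertible matrices
    of every large enough size; one size can thus be chosen for several bases and
    involutions at once. *)
Definition frame P (l : nat) : V :=
  if insub l is Some j then \sum_(i < n) P i j *: e i else e l.

Lemma frame_lt P (j : 'I_n) : frame P j = \sum_(i < n) P i j *: e i.
Proof. by rewrite /frame valK. Qed.

Lemma frame_ge P l : (n <= l)%N -> frame P l = e l.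
Proof. by move=> nl; rewrite /frame insubF // ltnNge nl. Qed.

Lemma frame1 : frame 1%:M = e.
Proof.
apply/funext => l; have [ln|nl] := ltnP l n; last exact: frame_ge.
rewrite (frame_lt _ (Ordinal ln)) (bigD1 (Ordinal ln)) //= mxE eqxx scale1r.
rewrite big1 ?addr0 // => i /negbTE il.
by rewrite mxE il scale0r.
Qed.

Lemma frameM P T (j : 'I_n) :
  frame (P *m T) j = \sum_(i < n) T i j *: frame P i.
Proof.
under eq_bigr do rewrite frame_lt scaler_sumr.
rewrite exchange_big frame_lt; apply: eq_bigr => i _ /=.
rewrite mxE scaler_suml; apply: eq_bigr => k _.
by rewrite scalerA mulrC.
Qed.

Lemma frame_linear (g : {linear V -> V}) P Q :
  (forall l, g (e l) = frame P l) -> forall l, g (frame Q l) = frame (P *m Q) l.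
Proof.
move=> gP l; have [ln|nl] := ltnP l n; last by rewrite !frame_ge // gP frame_ge.
rewrite (frame_lt _ (Ordinal ln)) (frameM _ _ (Ordinal ln)) linear_sum.
by apply: eq_bigr => i _; rewrite linearZ /= gP.
Qed.

Lemma frame_basis P : P \in unitmx -> is_basis (frame P).
Proof.
move=> uP; have [g gE] := linear_on_basis be (frame P).
have [h hE] := linear_on_basis be (frame (invmx P)).
have gb : bijective g.
  exists h => x.
    apply: (@linear_ext _ _ _ be (h \o g) idfun) => l /=.
    by rewrite gE (frame_linear _ hE) mulVmx // frame1.
  apply: (@linear_ext _ _ _ be (g \o h) idfun) => l /=.
  by rewrite hE (frame_linear _ gE) mulmxV // frame1.
have -> : frame P = g \o e by apply/funext => l /=; rewrite gE.
exact: basis_image.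
Qed.

Lemma frame_E_basis P : P \in unitmx -> E_basis e (frame P).
Proof.
move=> uP; split; first exact: frame_basis.
by apply/almost_allP; exists n => l; exact: frame_ge.
Qed.

Lemma coord_frame P T : P \in unitmx -> forall l k,
  coord (frame P) (frame (P *m T) l) k =
  if insub l is Some j then if insub k is Some i then T i j else 0
  else (k == l)%:R.
Proof.
move=> uP l k; have bP := frame_basis uP.
have [ln|nl] := ltnP l n; last first.
  rewrite insubF ?ltnNge ?nl // frame_ge // -(frame_ge P nl).
  exact: coord_basis.
rewrite (insubT (fun i => i < n)%N ln) /= (frameM _ _ (Ordinal ln)) coord_sum //.
have [kn|nk] := ltnP k n.
  rewrite (insubT (fun i => i < n)%N kn) /= (bigD1 (Ordinal kn)) //= coordZ // coord_basis //.
  rewrite eqxx mulr1 big1 ?addr0 // => i ik; rewrite coordZ // coord_basis //.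
  move: ik; rewrite -val_eqE /= eq_sym => /negbTE ->.
  by rewrite mulr0.
rewrite insubF ?ltnNge ?nk //; apply: big1 => i _.
by rewrite coordZ // coord_basis // gtn_eqF ?mulr0 // (leq_trans _ nk).
Qed.

Lemma frame_matrix v : is_basis v -> (forall l, (n <= l)%N -> v l = e l) ->
  (forall l k, (l < n)%N -> (n <= k)%N -> coord e (v l) k = 0) ->
  exists2 P, P \in unitmx & v = frame P.
Proof.
move=> bv ve vn; pose P : 'M[C]_n := \matrix_(i, j) coord e (v j) i.
have vE : v = frame P.
  apply/funext => l; have [ln|nl] := ltnP l n; last by rewrite ve // frame_ge.
  rewrite (frame_lt _ (Ordinal ln)) [LHS](@coord_expand _ _ _ be _ n).
    by apply: eq_bigr => i _; rewrite mxE.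
  by move=> k; exact: vn.
exists P => //; rewrite -unitmx_tr -row_free_unit -kermx_eq0.
apply/eqP/row_matrixP => i; rewrite row0.
have /sub_kermxP : (row i (kermx P^T) <= kermx P^T)%MS by exact: row_sub.
move: (row i _) => x xP.
(* A linear relation between the columns of [P] is one between the [v j]. *)
have : \sum_(j < n) x 0 j *: v j = 0.
  rewrite vE; under eq_bigr do rewrite frame_lt scaler_sumr.
  rewrite exchange_big; apply: big1 => k _ /=.
  have /matrixP/(_ 0 k) := xP; rewrite mxE [RHS]mxE => xk.
  under eq_bigr do rewrite scalerA.
  rewrite -scaler_suml (eq_bigr (fun j => x 0 j * P^T j k)) => [|j _].
    by rewrite xk scale0r.
  by rewrite [in RHS]mxE.
move=> sum0; apply/rowP => j; rewrite mxE.
have := coord0 bv j; rewrite -sum0 coord_sum // (bigD1 j) //= big1 ?addr0.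
  by rewrite coordZ // coord_basis // eqxx mulr1.
move=> k kj; rewrite coordZ // coord_basis // -[_ == _]/(j == k) eq_sym.
by rewrite (negbTE kj) mulr0.
Qed.

Section Flag.
Variables (d : Order.disp_t) (A : orderType d) (sigma : nat -> A).
Hypothesis sigmaI : injective sigma.
Local Notation r := (fun i : 'I_n => sigma i).

Lemma order_inj : injective r.
Proof. by move=> i j /sigmaI/val_inj. Qed.

Lemma triangular_frame_flag P T : P \in unitmx -> triangular r T ->
  flag sigma (frame (P *m T)) = flag sigma (frame P).
Proof.
move=> uP tT; have uPT : P *m T \in unitmx by rewrite unitmx_mul uP (proj1 tT).
have mono Q S : Q \in unitmx -> triangular r S -> forall k l,
    coord (frame Q) (frame (Q *m S) l) k != 0 -> (sigma k <= sigma l)%O.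
  move=> uQ tS k l; rewrite coord_frame //.
  case: insubP => [j _ <-|_]; last by have [->|] := eqVneq k l; rewrite ?eqxx ?lexx.
  by case: insubP => [i _ <- /(proj2 tS)|]; rewrite ?eqxx.
apply/esym/triangular_flag; [exact: frame_basis|exact: frame_basis|exact: mono|].
rewrite -{2}(mulmxK (proj1 tT) P); apply: mono => //.
exact (triangular_inv order_inj tT).
Qed.

Lemma flag_frame_triangular P Q : P \in unitmx -> Q \in unitmx ->
  flag sigma (frame P) = flag sigma (frame Q) -> triangular r (invmx P *m Q).
Proof.
move=> uP uQ fPQ; split; first by rewrite unitmx_mul unitmx_inv uP.
move=> i j ij.
apply: (flag_eq_coord (frame_basis uP) (frame_basis uQ) _ fPQ).
  by exists n => l nl; rewrite !frame_ge.
by rewrite -[Q](mulKVmx uP) coord_frame // !valK.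
Qed.

End Flag.
End FixedSize.

Lemma E_basis_frame v : E_basis e v -> exists N, forall n, (N <= n)%N ->
  exists2 P : 'M[C]_n, P \in unitmx & v = frame P.
Proof.
move=> [bv /almost_allP[N0 vN]].
have [M MP] := choice (fun l => coord_bound be (v l)).
exists (maxn N0 (\max_(l < N0) M l)) => n; rewrite geq_max => /andP[Nn Mn].
apply: frame_matrix => // [l nl|l k ln nk].
  by apply: vN; exact: leq_trans nl.
have [lN|Nl] := ltnP l N0; last first.
  by rewrite vN // coord_basis // gtn_eqF // (leq_trans ln).
apply: MP; apply: leq_trans (leq_trans Mn nk).
exact: (leq_bigmax (F := fun l : 'I_N0 => M l) (Ordinal lN)).
Qed.

End Frames.

(** * Matrices of the form and of the conjugation *)

Section Reduction.
Variables (R : realType) (V : lmodType R[i]) (e : nat -> V) (be : is_basis e).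
Variables (t : typeA) (Om : nat -> nat -> R[i]) (io : nat -> nat).
Hypothesis pairing : Omega_pairing t Om io.
Local Notation C := R[i].
Local Notation cj := (@conjc R : {rmorphism C -> C}).
Local Notation bar := (map_mx conjc).
Local Notation unitary Q := ((bar Q)^T *m Q = 1%:M).
Local Notation eps := (sign_of R t).
Local Notation omega := (omega e Om).
Local Notation gamma := (gamma e Om).

Let ioK := pairing_invol pairing.

Section FixedSize.
Variables (n : nat) (stable : forall k, (io k < n)%N = (k < n)%N).
Implicit Types P Q T : 'M[C]_n.
Implicit Types w : 'I_n -> 'I_n.

Definition Omega_mx : 'M[C]_n := \matrix_(i, j) Om i j.
Local Notation O := Omega_mx.

Lemma io_lt (i : 'I_n) : (io i < n)%N.
Proof. by rewrite stable. Qed.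

Definition io_ord (i : 'I_n) := Ordinal (io_lt i).

Lemma io_ordK : involutive io_ord.
Proof. by move=> i; apply/val_inj; exact: ioK. Qed.

Lemma Omega_mx_signed : signed_monomial io_ord O.
Proof.
move=> i j; rewrite mxE (pairing_sym pairing j i); split=> [ij|->].
  rewrite (pairing_zero pairing) ?mulr0 // => h; apply: ij.
  exact: val_inj.
rewrite /sign_of /=; case: (pairing_unit pairing j) => ->.
  by case: t; rewrite mulr1; [left|right].
by case: t; rewrite ?mul1r ?mulrNN ?mulr1; [right|left].
Qed.

Lemma Omega_mx_bar : bar O = O.
Proof. by apply/matrixP => i j; rewrite !mxE (Om_conj pairing). Qed.

Lemma Omega_mx_tr : O^T = eps *: O.
Proof. by apply/matrixP => i j; rewrite !mxE (pairing_sym pairing). Qed.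

Lemma Omega_mx_orthogonal : O^T *m O = 1%:M.
Proof.
apply/matrixP => i j; rewrite mxE (bigD1 (io_ord j)) //= big1 ?addr0 => [|k kj].
  rewrite !mxE /=; have [->|/eqP ij] := eqVneq i j.
    by have := Om_io_sqr pairing (io j); rewrite ioK.
  rewrite (pairing_zero pairing) ?mul0r // ioK => ij'.
  by apply: ij; exact: val_inj.
rewrite [O k j]mxE (pairing_zero pairing) ?mulr0 // => jk; case/eqP: kj.
by apply: val_inj; rewrite /= jk ioK.
Qed.

Lemma Omega_mx_unitary : unitary O.
Proof. by rewrite Omega_mx_bar Omega_mx_orthogonal. Qed.

Lemma Omega_mx_sqr : O *m O = eps%:M.
Proof.
have := Omega_mx_orthogonal; rewrite Omega_mx_tr -scalemxAl => h.
by rewrite -[LHS]scale1r -(eps_sqr R t) -scalerA h scalemx1.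
Qed.

Lemma Omega_mx_unit : O \in unitmx.
Proof. exact: unitary_unit Omega_mx_unitary. Qed.

Lemma omega_frame P (i j : 'I_n) : omega (frame e P i) (frame e P j) = (P^T *m O *m P) i j.
Proof.
rewrite !frame_lt (omega_suml be pairing) -mulmxA mxE; apply: eq_bigr => k _.
rewrite (omegaZl be pairing) !mxE (omega_sumr be pairing); congr (_ * _).
apply: eq_bigr => l _; rewrite (omegaZr be pairing) (omega_basis be pairing).
by rewrite mxE mulrC.
Qed.

Lemma omega_frame_ge P (i : 'I_n) l : (n <= l)%N ->
  omega (frame e P i) (e l) = 0 /\ omega (e l) (frame e P i) = 0.
Proof.
move=> nl; have z (k : 'I_n) : Om k l = 0.
  apply: (pairing_zero pairing) => lE.
  by have := io_lt k; rewrite -lE ltnNge nl.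
rewrite frame_lt (omega_suml be pairing) (omega_sumr be pairing).
split; apply: big1 => k _.
  by rewrite (omegaZl be pairing) (omega_basis be pairing) z mulr0.
rewrite (omegaZr be pairing) (omega_basis be pairing) (pairing_sym pairing k).
by rewrite z !mulr0.
Qed.

Lemma gamma_basis l : gamma (e l) = Om (io l) l *: e (io l).
Proof.
apply: (coord_inj be); apply/funext => k.
rewrite (gammaE be pairing) coordZ // !coord_basis //.
have [->|kl] := eqVneq k (io l); first by rewrite ioK eqxx conjc1.
have -> : (io k == l) = false.
  by apply/eqP => h; case/eqP: kl; rewrite -h ioK.
by rewrite conjc0 !mulr0.
Qed.

Lemma gamma_frame P (j : 'I_n) : P \in unitmx -> gamma (frame e P j) =
  \sum_(k < n) (invmx P *m O *m bar P) k j *: frame e P k.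
Proof.
move=> uP; rewrite -frameM !mulmxA mulmxV // mul1mx !frame_lt.
rewrite (gamma_sum be pairing).
have gE (i : 'I_n) : gamma (e i) = \sum_(k < n) O k i *: e k.
  rewrite gamma_basis (bigD1 (io_ord i)) //= mxE big1 ?addr0 // => k ki.
  rewrite mxE (pairing_zero pairing) ?scale0r // => h; case/eqP: ki.
  by apply: val_inj; rewrite /= h ioK.
under eq_bigr do rewrite (gammaZ be pairing) gE scaler_sumr.
rewrite exchange_big; apply: eq_bigr => k _ /=.
rewrite mxE scaler_suml; apply: eq_bigr => i _.
by rewrite scalerA mulrC !mxE.
Qed.

Definition extend w (l : nat) : nat :=
  if insub l is Some j then w j else io l.

Lemma extend_lt w (j : 'I_n) : extend w j = w j.
Proof. by rewrite /extend valK. Qed.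

Lemma extend_ge w l : (n <= l)%N -> extend w l = io l.
Proof. by move=> nl; rewrite /extend insubF // ltnNge nl. Qed.

Lemma io_ge l : (n <= l)%N -> (n <= io l)%N.
Proof. by rewrite leqNgt -stable -leqNgt. Qed.

Lemma dual_frame w P : P \in unitmx ->
  dual_basis e Om (extend w) (frame e P) <->
  signed_monomial w (P^T *m O *m P).
Proof.
move=> uP; split=> [[_ dP] i j|sP].
  have := dP j i; rewrite omega_frame extend_lt => -[z u]; split=> [ij|ij].
    by apply: z => /val_inj.
  by apply: u; rewrite ij.
split=> [|k l]; first exact: frame_E_basis.
have [kn|nk] := ltnP k n; have [ln|nl] := ltnP l n.
- rewrite (extend_lt _ (Ordinal kn)) (omega_frame _ (Ordinal ln) (Ordinal kn)).
  have [z u] := sP (Ordinal ln) (Ordinal kn); split=> [lk|lk].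
    by apply: z => lE; apply: lk; rewrite -lE.
  by apply: u; exact: val_inj.
- rewrite (extend_lt _ (Ordinal kn)) [frame e P l]frame_ge //.
  have [_ ->] := omega_frame_ge P (Ordinal kn) nl; split=> // lE.
  by move: nl; rewrite lE leqNgt ltn_ord.
- rewrite extend_ge // [frame e P k]frame_ge //.
  have [-> _] := omega_frame_ge P (Ordinal ln) nk; split=> // lE.
  by have := io_ge nk; rewrite -lE leqNgt ln.
rewrite extend_ge // !frame_ge // (omega_basis be pairing).
split=> [lk|->].
  by apply: (pairing_zero pairing) => kE; apply: lk; rewrite kE ioK.
by have := pairing_unit pairing (io k); rewrite ioK.
Qed.

Lemma conjugate_frame w P : P \in unitmx ->
  conjugate_basis e Om (extend w) (frame e P) <->
  signed_monomial w (invmx P *m O *m bar P).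
Proof.
move=> uP; have bP := frame_basis be uP; split=> [[_ cP] i j|sP].
  have co : (invmx P *m O *m bar P) i j = coord (frame e P) (gamma (frame e P j)) i.
    rewrite gamma_frame // coord_sum // (bigD1 i) //= coordZ // coord_basis //.
    rewrite eqxx mulr1 big1 ?addr0 // => k ki; rewrite coordZ // coord_basis //.
    by rewrite -[_ == _]/(i == k) eq_sym (negbTE ki) mulr0.
  have := cP j; rewrite extend_lt co => -[] ->; split=> [ij|->].
  - by rewrite coord_basis // -[_ == _]/(i == w j); case: eqP.
  - by rewrite coord_basis // eqxx; left.
  - by rewrite coordN // coord_basis // -[_ == _]/(i == w j); case: eqP; rewrite ?oppr0.
  - by rewrite coordN // coord_basis // eqxx; right.
split=> [|k]; first exact: frame_E_basis.
have [kn|nk] := ltnP k n; last first.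
  rewrite extend_ge // !frame_ge ?io_ge // gamma_basis.
  have := pairing_unit pairing (io k); rewrite ioK => -[] ->.
    by left; rewrite scale1r.
  by right; rewrite scaleN1r.
rewrite (extend_lt _ (Ordinal kn)) (gamma_frame (Ordinal kn)) //.
set j := Ordinal kn; rewrite (bigD1 (w j)) //= big1 ?addr0 => [|i ij].
  by case: (proj2 (sP (w j) j) erefl) => ->; [left|right]; rewrite ?scale1r ?scaleN1r.
by rewrite (proj1 (sP i j)) ?scale0r //; apply/eqP.
Qed.

Lemma extend_I_eps w : involutive w -> (t = A2 -> forall i, w i <> i) ->
  I_eps e Om t (extend w).
Proof.
move=> wK wfree.
have I : I_inf e Om (extend w).
  split.
    move=> l; have [ln|nl] := ltnP l n.
      by rewrite (extend_lt _ (Ordinal ln)) extend_lt wK.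
    by rewrite !extend_ge ?io_ge ?ioK.
  apply/almost_allP; exists n => l nl.
  by rewrite (iota_starE be pairing) extend_ge.
rewrite /I_eps; case tE: t => //; split=> // l.
have [ln|nl] := ltnP l n.
  rewrite (extend_lt _ (Ordinal ln)) => h; apply: (wfree tE (Ordinal ln)).
  exact: val_inj.
by rewrite extend_ge //; exact: (pairing_free pairing).
Qed.

Lemma I_eps_restrict (w : nat -> nat) : I_eps e Om t w ->
  (forall l, (n <= l)%N -> w l = io l) ->
  exists wn : 'I_n -> 'I_n, [/\ involutive wn, t = A2 -> forall i, wn i <> i
    & w = extend wn].
Proof.
move=> Iw wge.
have wK : involutive w by move: Iw; rewrite /I_eps; case: t => -[] // [].
have lt (i : 'I_n) : (w i < n)%N.
  rewrite ltnNge; apply/negP => nw; have := wge _ nw; rewrite wK => iE.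
  by move: (io_ge nw); rewrite -iE leqNgt ltn_ord.
exists (fun i => Ordinal (lt i)); split.
- by move=> i; apply: val_inj; exact: wK.
- by move=> tE i; move: Iw; rewrite /I_eps tE => -[_ h] /(congr1 val); exact: h.
apply/funext => l; have [ln|nl] := ltnP l n; last by rewrite extend_ge // wge.
by rewrite (extend_lt _ (Ordinal ln)).
Qed.

End FixedSize.

End Reduction.

(** * Adapted bases of a flag *)

Section AdaptedBases.
Variables (R : realType) (V : lmodType R[i]) (e : nat -> V) (be : is_basis e).
Variables (t : typeA) (Om : nat -> nat -> R[i]) (io : nat -> nat).
Hypothesis pairing : Omega_pairing t Om io.
Variables (d : Order.disp_t) (A : orderType d) (sigma : nat -> A).
Hypothesis sigmaI : injective sigma.
Local Notation C := R[i].
Local Notation bar := (map_mx conjc).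
Local Notation eps := (sign_of R t).
Local Notation I_eps := (I_eps e Om t).
Local Notation dual := (dual_basis e Om).
Local Notation conjugate := (conjugate_basis e Om).
Implicit Types (w : nat -> nat) (v u : nat -> V).

Let ioK := pairing_invol pairing.

Lemma sign_of_cases : eps = 1 \/ eps = -1.
Proof. by rewrite /sign_of; case: t; [left|right]. Qed.

Lemma I_eps_invol w : I_eps w -> involutive w.
Proof. by rewrite /Defs.I_eps; case: t => -[] // []. Qed.

Lemma I_eps_io w : I_eps w -> exists N, forall l, (N <= l)%N -> w l = io l.
Proof.
move=> Iw; rewrite -(iota_starE be pairing); apply/almost_allP.
by move: Iw; rewrite /Defs.I_eps; case: t => -[] // [].
Qed.

Lemma dual_reduction v : E_basis e v -> exists w v',
  [/\ I_eps w, dual w v' & flag sigma v' = flag sigma v].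
Proof.
move=> /(E_basis_frame be)[N NP]; have [n Nn nP] := pairing_cofinal pairing N.
have [P uP ->] := NP n Nn.
pose M := P^T *m Omega_mx Om n *m P.
have uM : M \in unitmx.
  by rewrite !unitmx_mul unitmx_tr uP (Omega_mx_unit pairing nP).
have Mt : M^T = eps *: M.
  by rewrite !trmx_mul trmxK (Omega_mx_tr pairing) -scalemxAl -scalemxAr mulmxA.
have [T [w [tT wK wfree sT]]] :=
  symmetric_signed_monomial (@order_inj n _ _ _ sigmaI) sign_of_cases uM Mt.
have uPT : P *m T \in unitmx by rewrite unitmx_mul uP (proj1 tT).
exists (extend io w), (frame e (P *m T)); split.
- apply: (extend_I_eps be pairing nP) => // tE; apply: wfree.
  by rewrite /sign_of tE.
- apply/(dual_frame be pairing nP) => //.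
  by rewrite trmx_mul !mulmxA in sT *.
- exact: triangular_frame_flag.
Qed.

Lemma conjugate_reduction v : E_basis e v -> exists w v',
  [/\ I_eps w, conjugate w v' & flag sigma v' = flag sigma v].
Proof.
move=> /(E_basis_frame be)[N NP]; have [n Nn nP] := pairing_cofinal pairing N.
have [P uP ->] := NP n Nn.
pose M := invmx P *m Omega_mx Om n *m bar P.
have uP' : bar P \in unitmx by rewrite map_unitmx.
have MM : M *m bar M = eps%:M.
  rewrite !map_mxM barK map_invmx (Omega_mx_bar pairing) /M !mulmxA.
  rewrite mulmxK // -(mulmxA (invmx P)) (Omega_mx_sqr pairing nP).
  by rewrite mul_mx_scalar -scalemxAl mulVmx // scalemx1.
have [T [w [tT wK wfree sT]]] :=
  conjugation_signed_monomial (@order_inj n _ _ _ sigmaI) sign_of_cases MM.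
have uPT : P *m T \in unitmx by rewrite unitmx_mul uP (proj1 tT).
exists (extend io w), (frame e (P *m T)); split.
- apply: (extend_I_eps be pairing nP) => // tE; apply: wfree.
  by rewrite /sign_of tE.
- apply/(conjugate_frame be pairing nP) => //.
  by rewrite invmxM ?(proj1 tT) // map_mxM !mulmxA in sT *.
- exact: triangular_frame_flag.
Qed.

Lemma dual_conjugate_flag w v v' : I_eps w -> dual w v -> conjugate w v' ->
  flag sigma v = flag sigma v' ->
  exists v'', [/\ dual w v'', conjugate w v'' & flag sigma v'' = flag sigma v].
Proof.
move=> Iw dv cv fE.
have [N1 NP1] := E_basis_frame be (proj1 dv).
have [N2 NP2] := E_basis_frame be (proj1 cv).
have [N3 wio] := I_eps_io Iw.
have [n Nn nP] := pairing_cofinal pairing (maxn N1 (maxn N2 N3)).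
move: Nn; rewrite !geq_max => /and3P[Nn1 Nn2 Nn3].
have [P uP vE] := NP1 n Nn1; have [Q uQ vE'] := NP2 n Nn2.
have [|wn [wnK _ wE]] := I_eps_restrict nP Iw.
  by move=> l nl; apply: wio; exact: leq_trans nl.
rewrite {}wE {}vE {}vE' in dv cv fE *.
have tX := flag_frame_triangular be uP uQ fE.
move: dv => /(dual_frame be pairing nP _ uP) dP.
move: cv => /(conjugate_frame be pairing nP _ uQ) cQ.
have [|T [tT dT cT]] := dual_conjugate_reduction (@order_inj n _ _ _ sigmaI)
  wnK sign_of_cases (Omega_mx_bar pairing n) (Omega_mx_unitary pairing nP)
  (Omega_mx_sqr pairing nP) uP tX dP.
  by rewrite mulKVmx.
have uPT : P *m T \in unitmx by rewrite unitmx_mul uP (proj1 tT).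
exists (frame e (P *m T)); split.
- exact/(dual_frame be pairing nP).
- exact/(conjugate_frame be pairing nP).
- exact: triangular_frame_flag.
Qed.

Lemma dual_conjugate_exists w : I_eps w -> exists v, dual w v /\ conjugate w v.
Proof.
move=> Iw; have [N wio] := I_eps_io Iw.
have [n Nn nP] := pairing_cofinal pairing N.
have [|wn [wnK wfree ->]] := I_eps_restrict nP Iw.
  by move=> l nl; apply: wio; exact: leq_trans nl.
have sO := Omega_mx_signed pairing nP.
have [|Q uQ sQ] := exists_signed_unitary (io_ordK pairing nP) wnK sO.
  case tE: t wfree => wfree; [left|right; split=> [i|]].
  - move=> i j; rewrite mxE; have [->|/eqP ij] := eqVneq i (io_ord nP j).
      by rewrite /= -{2}(ioK j) (pairing_one pairing).
    by have := proj1 (sO i j) ij; rewrite mxE.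
  - by move=> /(congr1 val); exact: (pairing_free pairing).
  - exact: wfree.
have uQ' := unitary_unit uQ.
exists (frame e Q); split.
  apply/(dual_frame be pairing nP) => //.
  rewrite -(bar_conjugate (Omega_mx_bar pairing n) uQ).
  exact: signed_monomial_bar.
exact/(conjugate_frame be pairing nP).
Qed.

End AdaptedBases.

(** * Relative position and orbits *)

Section Orbits.
Variables (R : realType) (V : lmodType R[i]) (e : nat -> V) (be : is_basis e).
Variables (t : typeA) (Om : nat -> nat -> R[i]) (io : nat -> nat).
Hypothesis pairing : Omega_pairing t Om io.
Variables (d : Order.disp_t) (A : orderType d) (sigma : nat -> A).
Hypothesis sigmaI : injective sigma.
Local Notation C := R[i].
Local Notation eps := (sign_of R t).
Local Notation omega := (omega e Om).
Local Notation gamma := (gamma e Om).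
Local Notation I_eps := (I_eps e Om t).
Local Notation dual := (dual_basis e Om).
Local Notation conjugate := (conjugate_basis e Om).
Local Notation G := (G e).
Implicit Types (w : nat -> nat) (v u : nat -> V) (g : {linear V -> V}).

Let ioK := pairing_invol pairing.

Lemma omega_dual w v x k : involutive w -> dual w v ->
  omega x (v k) = coord v x (w k) * omega (v (w k)) (v k).
Proof.
move=> wK [[bv _] dv]; have [N xN] := coord_bound bv x.
have xM l : (maxn N (w k).+1 <= l)%N -> coord v x l = 0.
  by rewrite geq_max => /andP[/xN].
have wM : (w k < maxn N (w k).+1)%N by rewrite leq_max leqnn orbT.
rewrite [x in LHS](coord_expand bv xM) (omega_suml be pairing).
rewrite (bigD1 (Ordinal wM)) //= (omegaZl be pairing) big1 ?addr0 // => l lw.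
rewrite (omegaZl be pairing) (proj1 (dv k l)) ?mulr0 // => lE.
by case/eqP: lw; exact: val_inj.
Qed.

Lemma dual_neq0 w v k : dual w v -> omega (v (w k)) (v k) != 0.
Proof.
by move=> [_ dv]; case: (proj2 (dv k (w k)) erefl) => ->; rewrite ?oppr_eq0 oner_eq0.
Qed.

Lemma down_set_dual D : down_set (sigma : nat -> A^d) D <-> down_set sigma (~` D).
Proof.
have E (b : A) : ~` [set l | ((sigma l : A^d) < b)%O] = [set l | (sigma l <= b)%O].
  by apply/seteqP; split=> l /=; rewrite ltEdual leNgt => /negP.
have E' (b : A) : ~` [set l | ((sigma l : A^d) <= b)%O] = [set l | (sigma l < b)%O].
  by apply/seteqP; split=> l /=; rewrite leEdual ltNge => /negP.
split=> -[b [bE|bE]]; exists b.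
- by right; rewrite bE E.
- by left; rewrite bE E'.
- by right; rewrite -[D]setCK bE -E' setCK.
- by left; rewrite -[D]setCK bE -E setCK.
Qed.

Lemma flag_perpE w v : I_eps w -> dual w v ->
  flag_perp e Om (flag sigma v) = flag (sigma : nat -> A^d) (v \o w).
Proof.
move=> /(@I_eps_invol _ _ _ _ _) wK dv; have bv := proj1 (proj1 dv).
have [bvw cvw] := basis_reindex bv wK wK.
have perpE D : perp e Om (coord_span v D) = coord_span (v \o w) (~` D).
  apply/seteqP; split=> x /= h.
    move=> l /contrapT Dl; rewrite cvw.
    have := h _ (coord_span_basis bv Dl); rewrite (omega_dual _ _ wK dv) => /eqP.
    by rewrite mulf_eq0 (negbTE (dual_neq0 _ dv)) orbF => /eqP.
  move=> y yD; have [N yN] := coord_bound bv y.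
  rewrite (coord_expand bv yN) (omega_sumr be pairing); apply: big1 => k _.
  rewrite (omegaZr be pairing); have [Dk|/yD ->] := pselect (D k); last by rewrite mul0r.
  by rewrite (omega_dual _ _ wK dv) -cvw h ?mul0r ?mulr0 //= => nD; apply: nD.
rewrite !flagE // /flag_perp; apply/seteqP; split.
  move=> _ [_ [D dD <-] <-]; exists (~` D); last by rewrite perpE.
  by apply/down_set_dual; rewrite setCK.
move=> _ [D /down_set_dual dD <-]; exists (coord_span v (~` D)); first by exists (~` D).
by rewrite perpE setCK.
Qed.

Lemma conjugate_sign w v k : conjugate w v ->
  exists2 s : C, s = 1 \/ s = -1 & gamma (v k) = s *: v (w k).
Proof.
move=> [_ /(_ k) []->]; first by exists 1; [left|rewrite scale1r].
by exists (-1); [right|rewrite scaleN1r].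
Qed.

Lemma flag_gammaE w v : I_eps w -> conjugate w v ->
  flag_gamma e Om (flag sigma v) = flag sigma (v \o w).
Proof.
move=> /(@I_eps_invol _ _ _ _ _) wK cv; have bv := proj1 (proj1 cv).
have [bvw cvw] := basis_reindex bv wK wK.
have sub a b D x : is_basis a -> is_basis b ->
    (forall k, exists s : C, gamma (a k) = s *: b k) ->
    coord_span a D x -> coord_span b D (gamma x).
  move=> ba bb ab xD l nDl; have [N xN] := coord_bound ba x.
  rewrite (coord_expand ba xN) (gamma_sum be pairing) coord_sum //.
  apply: big1 => k _; rewrite (gammaZ be pairing).
  have [s ->] := ab k; rewrite !coordZ // coord_basis //.
  have [lk|_] := eqVneq l k; last by rewrite !mulr0.
  by rewrite xD ?conjc0 ?mul0r // -lk.
have gE D : gamma @` coord_span v D = coord_span (v \o w) D.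
  apply/seteqP; split=> [_ [x xD <-]|x xD].
    apply: (sub v) => // k; have [s _ ->] := conjugate_sign k cv.
    by exists s.
  exists (gamma (eps *: x)).
    apply: (sub (v \o w)) => //.
      move=> k; have [s _ ->] := conjugate_sign (w k) cv.
      by exists s; rewrite wK.
    by move=> l /xD x0; rewrite coordZ // x0 mulr0.
  by rewrite (gammaK be pairing) scalerA eps_sqr scale1r.
rewrite !flagE // /flag_gamma; apply/seteqP; split.
  by move=> _ [_ [D dD <-] <-]; exists D => //; rewrite gE.
move=> _ [D dD <-]; exists (coord_span v D); first by exists D.
by rewrite gE.
Qed.

Lemma act_flag (d' : Order.disp_t) (B : orderType d') (tau : nat -> B) g v :
  bijective g -> is_basis v -> act g (flag tau v) = flag tau (g \o v).
Proof.
move=> gb bv; have bgv := basis_image bv gb.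
have gE D : g @` coord_span v D = coord_span (g \o v) D.
  apply/seteqP; split=> [_ [x xD <-] l nDl|x xD].
    by rewrite coord_image // xD.
  have [h _ gh] := gb; exists (h x) => // l nDl.
  by rewrite -(coord_image bv gb) gh xD.
rewrite !flagE // /act; apply/seteqP; split.
  by move=> _ [_ [D dD <-] <-]; exists D => //; rewrite gE.
move=> _ [D dD <-]; exists (coord_span v D); first by exists D.
by rewrite gE.
Qed.

Lemma G_E_basis g v : G g -> E_basis e v -> E_basis e (g \o v).
Proof.
move=> [gb /almost_allP[N gN]] [bv /almost_allP[M vM]].
split; first exact: basis_image.
apply/almost_allP; exists (maxn N M) => l; rewrite geq_max => /andP[Nl Ml].
by rewrite /= vM // gN.
Qed.

Lemma G_transport v u : E_basis e v -> E_basis e u ->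
  exists2 g, G g & forall l, g (v l) = u l.
Proof.
move=> [bv /almost_allP[N vN]] [bu /almost_allP[M uM]].
have [g [gb gE]] := basis_change bv bu; exists g => //; split=> //.
apply/almost_allP; exists (maxn N M) => l; rewrite geq_max => /andP[Nl Ml].
by rewrite -{1}vN // gE uM.
Qed.

Lemma XE (d' : Order.disp_t) (B : orderType d') (tau : nat -> B) :
  X e tau = [set flag tau v | v in [set v | E_basis e v]].
Proof.
have Ee : E_basis e e by split=> //; apply/almost_allP; exists 0%N.
apply/seteqP; split=> [_ [g Gg <-]|_ [v Ev <-]].
  exists (g \o e); first exact: G_E_basis.
  by rewrite act_flag //; case: Gg.
have [g Gg gE] := G_transport Ee Ev; exists g => //.
rewrite act_flag //; last by case: Gg.
by congr flag; apply/funext => l; exact: gE.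
Qed.

Lemma I_eps_large w N : I_eps w ->
  exists M, forall l, (M <= l)%N -> (N <= l)%N /\ (N <= w l)%N.
Proof.
move=> Iw; have [N' wio] := I_eps_io be pairing Iw.
have [n Nn nP] := pairing_cofinal pairing (maxn N N').
move: Nn; rewrite geq_max => /andP[Nn Nn']; exists n => l nl.
split; first exact: leq_trans nl.
by rewrite wio ?(leq_trans Nn') // (leq_trans Nn) // leqNgt nP -leqNgt.
Qed.

(** A flag in the right-hand side has an adapted basis for some [w'], and its
    position relative to its transform determines [w']. The order of the transform
    is given by [rho], the reversed order for [perp] and the given one for
    [gamma]. *)
Lemma relative_position_flags (d' : Order.disp_t) (B : orderType d')
    (rho : nat -> B) (good : (nat -> nat) -> (nat -> V) -> Prop)
    (sharp : set (set V) -> set (set V)) :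
  injective rho ->
  (forall w v, good w v -> E_basis e v) ->
  (forall v, E_basis e v ->
    exists w v', [/\ I_eps w, good w v' & flag sigma v' = flag sigma v]) ->
  (forall w v, I_eps w -> good w v ->
    sharp (flag sigma v) = flag rho (v \o w)) ->
  forall w, I_eps w -> [set flag sigma v | v in [set v | good w v]] =
    [set F | X e sigma F /\ OO e (rho \o io) sigma (w \o io) (sharp F, F)].
Proof.
move=> rhoI goodE red sharpE w Iw; have wK := I_eps_invol Iw.
have qp : cancel (io \o w) (w \o io) by move=> l /=; rewrite ioK wK.
have pq : cancel (w \o io) (io \o w) by move=> l /=; rewrite wK ioK.
have [Nw wio] := I_eps_io be pairing Iw.
have Ee : E_basis e e by split=> //; apply/almost_allP; exists 0%N.
apply/seteqP; split=> [_ [v gv <-]|F [XF [g Gg]]].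
  have Ev := goodE _ _ gv; have [bv /almost_allP[N vN]] := Ev.
  split; first by rewrite XE; exists v.
  have Evp : E_basis e (v \o (w \o io)).
    split; first by case: (basis_reindex bv pq qp).
    have [n Nn nP] := pairing_cofinal pairing (maxn N Nw).
    move: Nn; rewrite geq_max => /andP[Nn Nwn].
    apply/almost_allP; exists n => l nl /=; rewrite wio ?ioK ?vN //.
      exact: leq_trans nl.
    by rewrite (leq_trans Nwn) // leqNgt nP -leqNgt.
  have [g Gg gE] := G_transport Ee Evp; exists g => //.
  have {}gE : g \o e = v \o (w \o io) by apply/funext.
  have gb := proj1 Gg; rewrite !act_flag // gE (flag_reindex _ _ qp).
  rewrite (sharpE _ _ Iw gv); congr (_, _).
  exact: (@flag_reindex _ _ _ _ rho (v \o w) io io ioK).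
move=> [sE FE]; have gb := proj1 Gg; have Eu := G_E_basis Gg Ee.
pose v := (g \o e) \o (io \o w).
have uE : g \o e = v \o (w \o io).
  by apply/funext => l; rewrite /v /= wK ioK.
have Ev : E_basis e v.
  have [bu /almost_allP[N uN]] := Eu; split; first by case: (basis_reindex bu qp pq).
  apply/almost_allP; exists (maxn N Nw) => l; rewrite geq_max => /andP[Nl Nwl].
  by rewrite /v /= wio // ioK; exact: uN.
move: sE FE; rewrite !act_flag // uE (flag_reindex _ _ qp).
rewrite -[v \o (w \o io)]/((v \o w) \o io) (@flag_reindex _ _ _ _ rho (v \o w) io io ioK).
move=> sE FE; have [w' [v' [Iw' gv' vv']]] := red v Ev.
have Ev' := goodE _ _ gv'.
suff -> : w = w' by exists v' => //; rewrite vv'.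
have [[bv /almost_allP[N vN]] [bv' /almost_allP[N' vN']]] := (Ev, Ev').
have [Nw' wio'] := I_eps_io be pairing Iw'.
apply: (@relative_position _ _ _ _ _ _ sigma rho v v') => //.
- exists (maxn N N') => l; rewrite geq_max => /andP[Nl Nl'].
  by rewrite vN // vN'.
- exact: I_eps_invol Iw'.
- exists (maxn Nw Nw') => l; rewrite geq_max => /andP[Nl Nl'].
  by rewrite wio // wio'.
by rewrite -(sharpE _ _ Iw' gv') vv' FE -sE.
Qed.

Lemma orbit_of_good (H : set {linear V -> V}) (good : (nat -> V) -> Prop) v :
  H `<=` G -> (forall v, good v -> E_basis e v) ->
  (forall g v, H g -> good v -> good (g \o v)) ->
  (forall v v', good v -> good v' ->
     exists2 g, H g & flag sigma (g \o v) = flag sigma v') ->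
  good v ->
  [set flag sigma v | v in [set v | good v]] = orbit H (flag sigma v).
Proof.
move=> HG goodE stab trans gv; have bv := proj1 (goodE _ gv).
apply/seteqP; split=> [_ [v' gv' <-]|_ [g Hg <-]].
  have [g Hg gE] := trans _ _ gv gv'; exists g => //.
  by rewrite act_flag //; case: (HG _ Hg).
exists (g \o v); first exact: stab.
by rewrite act_flag //; case: (HG _ Hg).
Qed.

Lemma dual_stable g w v : K e Om g -> dual w v -> dual w (g \o v).
Proof.
move=> [Gg gO] [Ev dv]; split; first exact: G_E_basis.
by move=> k l; rewrite /= gO.
Qed.

Lemma conjugate_stable g w v : G0 e Om g -> conjugate w v -> conjugate w (g \o v).
Proof.
move=> [Gg gO] [Ev cv]; split; first exact: G_E_basis.
move=> k; rewrite /= gO; case: (cv k) => ->; first by left.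
by right; rewrite linearN.
Qed.

Lemma rescale w v r : I_eps w -> E_basis e v ->
  (forall k, r k = 1 \/ r k = -1) -> (forall k, r (w k) = r k) ->
  (exists N, forall k, (N <= k)%N -> r k = 1) ->
  exists c : nat -> C, [/\ forall k, c k * c (w k) = r k,
    forall k, c k * (c k)^*%C = 1, E_basis e (fun k => c k *: v k)
    & flag sigma (fun k => c k *: v k) = flag sigma v].
Proof.
move=> Iw [bv /almost_allP[N vN]] r1 rw [M rM]; have wK := I_eps_invol Iw.
pose c := half_phase w r.
have cn k : `|c k| = 1.
  by apply: half_phase_norm; case: (r1 k) => ->; rewrite ?normrN normr1.
have c0 k : c k != 0 by rewrite -normr_eq0 cn oner_eq0.
have [g gE] := linear_on_basis bv (fun k => c k *: v k).
have [h hE] := linear_on_basis bv (fun k => (c k)^-1 *: v k).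
have gb : bijective g.
  exists h => x.
    apply: (@linear_ext _ _ _ bv (h \o g) idfun) => l /=.
    by rewrite gE linearZ /= hE scalerA divff // scale1r.
  apply: (@linear_ext _ _ _ bv (g \o h) idfun) => l /=.
  by rewrite hE linearZ /= gE scalerA mulVf // scale1r.
have bcv : is_basis (fun k => c k *: v k).
  by rewrite (_ : (fun k => _) = g \o v); [exact: basis_image|apply/funext => l /=].
exists c; split.
- by move=> k; case: (half_phaseM r k wK); rewrite -/c => ->.
- by move=> k; rewrite -sqr_normc cn expr1n.
- split=> //; apply/almost_allP; exists (maxn N M) => l; rewrite geq_max => /andP[Nl Ml].
  by rewrite /c half_phase1 ?rM // scale1r vN.
apply: triangular_flag => // k l.
  have -> : v l = (c l)^-1 *: (c l *: v l) by rewrite scalerA mulVf // scale1r.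
  rewrite coordZ // (coord_basis bcv).
  by have [->|] := eqVneq k l; rewrite ?lexx // mulr0 eqxx.
rewrite coordZ // coord_basis //.
by have [->|] := eqVneq k l; rewrite ?lexx // mulr0 eqxx.
Qed.

Lemma omega_sym x y : omega y x = eps * omega x y.
Proof.
have [N xN] := coord_bound be x; have [M yM] := coord_bound be y.
rewrite (coord_expand be xN) (coord_expand be yM).
rewrite !(omega_suml be pairing) mulr_sumr.
under eq_bigr do rewrite (omega_sumr be pairing).
rewrite exchange_big; apply: eq_bigr => k _ /=.
rewrite (omega_sumr be pairing) mulr_sumr; apply: eq_bigr => l _.
rewrite !(omegaZl be pairing) !(omegaZr be pairing) !(omega_basis be pairing).
by rewrite (pairing_sym pairing k l); ring.
Qed.

Lemma omega_preserved v g : is_basis v ->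
  (forall k l, omega (g (v k)) (g (v l)) = omega (v k) (v l)) ->
  forall x y, omega (g x) (g y) = omega x y.
Proof.
move=> bv gv x y; have [N xN] := coord_bound bv x; have [M yM] := coord_bound bv y.
rewrite (coord_expand bv xN) (coord_expand bv yM) !linear_sum.
rewrite !(omega_suml be pairing); apply: eq_bigr => k _.
rewrite !(omega_sumr be pairing); apply: eq_bigr => l _.
by rewrite !linearZ /= !(omegaZl be pairing) !(omegaZr be pairing) gv.
Qed.

Lemma gamma_preserved v g : is_basis v ->
  (forall k, gamma (g (v k)) = g (gamma (v k))) ->
  forall x, gamma (g x) = g (gamma x).
Proof.
move=> bv gv x; have [N xN] := coord_bound bv x.
rewrite (coord_expand bv xN) (gamma_sum be pairing) !linear_sum.
rewrite (gamma_sum be pairing); apply: eq_bigr => k _.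
by rewrite (gammaZ be pairing) !linearZ /= (gammaZ be pairing) gv.
Qed.

(** The signs of two bases adapted to the same [w] may differ. The scalars [c]
    absorb the difference, so that [g] can respect the form or the conjugation. *)
Lemma transport_signs w v v' (eta eta' : nat -> C) :
  I_eps w -> E_basis e v -> E_basis e v' ->
  (forall k, eta k = 1 \/ eta k = -1) -> (forall k, eta' k = 1 \/ eta' k = -1) ->
  (forall k, eta (w k) = eps * eta k) -> (forall k, eta' (w k) = eps * eta' k) ->
  (exists N, forall k, (N <= k)%N -> eta k = eta' k) ->
  exists c g, [/\ G g, forall l, g (v l) = c l *: v' l,
    flag sigma (g \o v) = flag sigma v',
    forall k, c k * (c k)^*%C = 1 & forall k, c k * c (w k) = eta' k * eta k].
Proof.
move=> Iw Ev Ev' s1 s1' sw sw' [N sN].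
have sq (s : C) : s = 1 \/ s = -1 -> s * s = 1.
  by case=> ->; rewrite ?mulrNN mulr1.
have [|||c [cw cn Ec fc]] := @rescale w v' (fun k => eta' k * eta k) Iw Ev'.
- move=> k; case: (s1 k) => ->; case: (s1' k) => ->; rewrite ?mulrNN ?mulr1 ?mul1r;
  by [left|right].
- by move=> k; rewrite sw sw' mulrACA eps_sqr mul1r.
- by exists N => k kN; rewrite sN // sq.
have [g Gg gE] := G_transport Ev Ec; exists c, g; split=> //.
by rewrite -fc; congr flag; apply/funext => l /=; exact: gE.
Qed.

Lemma dual_signs w v : I_eps w -> dual w v ->
  let eta k := omega (v (w k)) (v k) in
  (forall k, eta k = 1 \/ eta k = -1) /\ (forall k, eta (w k) = eps * eta k).
Proof.
move=> Iw [_ dv] /=; split=> k; first exact: (proj2 (dv _ _)).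
by rewrite (I_eps_invol Iw); exact: omega_sym.
Qed.

Lemma conjugate_signs w v : I_eps w -> conjugate w v -> exists eta : nat -> C,
  [/\ forall k, gamma (v k) = eta k *: v (w k),
     forall k, eta k = 1 \/ eta k = -1 & forall k, eta (w k) = eps * eta k].
Proof.
move=> Iw cv; have bv := proj1 (proj1 cv).
have [|eta etaP] := @choice _ _ (fun k (s : C) =>
    (s = 1 \/ s = -1) /\ gamma (v k) = s *: v (w k)).
  by move=> k; have [s s1 gs] := conjugate_sign k cv; exists s.
exists eta; split=> k; try by case: (etaP k).
have [s1 gk] := etaP k; have [_ gwk] := etaP (w k).
have := gammaK be pairing (v k).
rewrite gk (gammaZ be pairing) gwk (I_eps_invol Iw) scalerA.
move=> /(congr1 (fun x => coord v x k)).
rewrite !coordZ // coord_basis // eqxx !mulr1 => <-.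
case: s1 => ->; first by rewrite conjc1 mul1r mulr1.
by rewrite (rmorphN1 (@conjc R : {rmorphism C -> C})) mulN1r mulrN1 opprK.
Qed.

Lemma transport_omega w v v' c g : I_eps w -> dual w v -> dual w v' ->
  (forall l, g (v l) = c l *: v' l) ->
  (forall k, c k * c (w k) = omega (v' (w k)) (v' k) * omega (v (w k)) (v k)) ->
  forall x y, omega (g x) (g y) = omega x y.
Proof.
move=> Iw dv dv' gE cw; apply: (omega_preserved (proj1 (proj1 dv))) => l k.
rewrite !gE (omegaZl be pairing) (omegaZr be pairing).
have [->|/eqP lk] := eqVneq l (w k); last first.
  by rewrite (proj1 (proj2 dv' _ _) lk) (proj1 (proj2 dv _ _) lk) !mulr0.
rewrite mulrA [c (w k) * _]mulrC cw mulrAC.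
suff -> : omega (v' (w k)) (v' k) * omega (v' (w k)) (v' k) = 1 by rewrite mul1r.
by case: (proj1 (dual_signs Iw dv') k) => ->; rewrite ?mulrNN mulr1.
Qed.

Lemma transport_gamma w v v' (eta eta' : nat -> C) c g : is_basis v ->
  (forall k, gamma (v k) = eta k *: v (w k)) ->
  (forall k, gamma (v' k) = eta' k *: v' (w k)) ->
  (forall k, eta k = 1 \/ eta k = -1) ->
  (forall l, g (v l) = c l *: v' l) ->
  (forall k, c k * (c k)^*%C = 1) -> (forall k, c k * c (w k) = eta' k * eta k) ->
  forall x, gamma (g x) = g (gamma x).
Proof.
move=> bv gv gv' s1 gE cn cw; apply: (gamma_preserved bv) => k.
rewrite gE (gammaZ be pairing) gv' gv [g (_ *: _)]linearZ /= gE !scalerA; congr (_ *: _).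
have -> : eta' k = c k * c (w k) * eta k.
  by rewrite cw -mulrA; case: (s1 k) => ->; rewrite ?mulrNN !mulr1.
by rewrite !mulrA [_^*%C * _]mulrC cn mul1r mulrC.
Qed.

Lemma dual_signs_eventually w v v' : I_eps w -> E_basis e v -> E_basis e v' ->
  exists N, forall k, (N <= k)%N ->
    omega (v (w k)) (v k) = omega (v' (w k)) (v' k).
Proof.
move=> Iw [_ /almost_allP[N vN]] [_ /almost_allP[M vM]].
have [L LP] := I_eps_large (maxn N M) Iw; exists L => k /LP[].
by rewrite !geq_max => /andP[? ?] /andP[? ?]; rewrite !vN // !vM.
Qed.

Lemma conjugate_signs_eventually w v v' (eta eta' : nat -> C) :
  I_eps w -> E_basis e v -> E_basis e v' ->
  (forall k, gamma (v k) = eta k *: v (w k)) ->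
  (forall k, gamma (v' k) = eta' k *: v' (w k)) ->
  exists N, forall k, (N <= k)%N -> eta k = eta' k.
Proof.
move=> Iw [bv /almost_allP[N vN]] [_ /almost_allP[M vM]] gv gv'.
have [L LP] := I_eps_large (maxn N M) Iw; exists L => k /LP[].
rewrite !geq_max => /andP[? ?] /andP[? ?].
have := gv k; have := gv' k; rewrite !vM // vN // => ->.
rewrite -(vN (w k)) // => /(congr1 (fun x => coord v x (w k))).
by rewrite !coordZ // coord_basis // eqxx !mulr1.
Qed.

Lemma K_transitive w v v' : I_eps w -> dual w v -> dual w v' ->
  exists2 g, K e Om g & flag sigma (g \o v) = flag sigma v'.
Proof.
move=> Iw dv dv'; have [s1 sw] := dual_signs Iw dv.
have [s1' sw'] := dual_signs Iw dv'.
have [c [g [Gg gE fg cn cw]]] := transport_signs Iw (proj1 dv) (proj1 dv')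
  s1 s1' sw sw' (dual_signs_eventually Iw (proj1 dv) (proj1 dv')).
by exists g => //; split=> //; exact: (transport_omega Iw dv dv' gE cw).
Qed.

Lemma G0_transitive w v v' : I_eps w -> conjugate w v -> conjugate w v' ->
  exists2 g, G0 e Om g & flag sigma (g \o v) = flag sigma v'.
Proof.
move=> Iw cv cv'; have [eta [gv s1 sw]] := conjugate_signs Iw cv.
have [eta' [gv' s1' sw']] := conjugate_signs Iw cv'.
have [c [g [Gg gE fg cn cw]]] := transport_signs Iw (proj1 cv) (proj1 cv')
  s1 s1' sw sw' (conjugate_signs_eventually Iw (proj1 cv) (proj1 cv') gv gv').
exists g => //; split=> //.
exact: (transport_gamma (proj1 (proj1 cv)) gv gv' s1 gE cn cw).
Qed.

(** The signs agree because [omega (gamma x) x] is nonnegative. One family of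
    scalars thus serves for the form and for the conjugation. *)
Lemma dual_conjugate_signs w v (eta : nat -> C) : dual w v ->
  (forall k, gamma (v k) = eta k *: v (w k)) ->
  (forall k, eta k = 1 \/ eta k = -1) ->
  forall k, omega (v (w k)) (v k) = eta k.
Proof.
move=> dv gv s1 k; have [N vN] := coord_bound be (v k).
have : 0 <= omega (gamma (v k)) (v k).
  by rewrite (omega_gamma be pairing vN); apply: sumr_ge0 => l _; exact: mulcJ_ge0.
rewrite gv (omegaZl be pairing).
have [->|->] := proj2 (proj2 dv k (w k)) erefl; case: (s1 k) => -> //.
  by rewrite mulr1 oppr_ge0 ler10.
by rewrite mul1r oppr_ge0 ler10.
Qed.

Lemma KG0_transitive w v v' : I_eps w -> dual w v /\ conjugate w v ->
  dual w v' /\ conjugate w v' ->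
  exists2 g, (K e Om `&` G0 e Om) g & flag sigma (g \o v) = flag sigma v'.
Proof.
move=> Iw [dv cv] [dv' cv']; have [eta [gv s1 sw]] := conjugate_signs Iw cv.
have [eta' [gv' s1' sw']] := conjugate_signs Iw cv'.
have [c [g [Gg gE fg cn cw]]] := transport_signs Iw (proj1 cv) (proj1 cv')
  s1 s1' sw sw' (conjugate_signs_eventually Iw (proj1 cv) (proj1 cv') gv gv').
exists g => //; split; split=> //.
  apply: (transport_omega Iw dv dv' gE) => k.
  by rewrite (dual_conjugate_signs dv gv) // (dual_conjugate_signs dv' gv').
exact: (transport_gamma (proj1 (proj1 cv)) gv gv' s1 gE cn cw).
Qed.

Lemma O_dual_orbit w v : I_eps w -> dual w v ->
  O_dual e Om sigma w = orbit (K e Om) (flag sigma v).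
Proof.
move=> Iw dv; apply: (@orbit_of_good _ (dual w)) dv => //; first by move=> g [].
- by move=> u [].
- by move=> g u; exact: dual_stable.
- by move=> u u'; exact: K_transitive.
Qed.

Lemma O_conj_orbit w v : I_eps w -> conjugate w v ->
  O_conj e Om sigma w = orbit (G0 e Om) (flag sigma v).
Proof.
move=> Iw cv; apply: (@orbit_of_good _ (conjugate w)) cv => //; first by move=> g [].
- by move=> u [].
- by move=> g u; exact: conjugate_stable.
- by move=> u u'; exact: G0_transitive.
Qed.

Lemma O_dual_conj w : I_eps w -> O_dual e Om sigma w `&` O_conj e Om sigma w =
  [set flag sigma v | v in [set v | dual w v /\ conjugate w v]].
Proof.
move=> Iw; apply/seteqP; split=> [F [[v dv vF] [v' cv' vF']]|_ [v [dv cv] <-]].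
  have [|u [du cu uF]] := dual_conjugate_flag be pairing sigmaI Iw dv cv'.
    by rewrite vF vF'.
  by exists u => //; rewrite uF.
by split; exists v.
Qed.

End Orbits.

Theorem proposition7 (R : realType) (V : lmodType R[i]) (e : nat -> V)
    (t : typeA) (Om : nat -> nat -> R[i])
    (d : Order.disp_t) (A : orderType d) (sigma : nat -> A)
    (e_basis : is_basis e) (Om_spec : is_Omega t Om)
    (sigma_bij : bijective sigma) :
  (forall w : nat -> nat, I_eps e Om t w ->
     O_dual e Om sigma w `&` O_conj e Om sigma w
       = [set flag sigma v
            | v in [set v | dual_basis e Om w v /\ conjugate_basis e Om w v]]
     /\ O_dual e Om sigma w `&` O_conj e Om sigma w !=set0)
  /\
  (forall w : nat -> nat, I_eps e Om t w ->
     O_dual e Om sigma w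
       = [set F | X e sigma F /\
            OO_perp e Om sigma (w \o iota_star e Om) (flag_perp e Om F, F)]
     /\
     O_conj e Om sigma w
       = [set F | X e sigma F /\
            OO_gamma e Om sigma (w \o iota_star e Om) (flag_gamma e Om F, F)])
  /\
  ([set O_dual e Om sigma w | w in I_eps e Om t]
     = [set orbit (K e Om) F | F in X e sigma]
   /\
   [set O_conj e Om sigma w | w in I_eps e Om t]
     = [set orbit (G0 e Om) F | F in X e sigma]
   /\
   (forall w : nat -> nat, I_eps e Om t w ->
      exists2 F, X e sigma F &
        O_dual e Om sigma w `&` O_conj e Om sigma w
          = orbit (K e Om `&` G0 e Om) F)).
Proof.
have sI := bij_inj sigma_bij; have [io pairing] := Omega_pairing_exists Om_spec.
have ex w := @dual_conjugate_exists _ _ _ e_basis _ _ _ pairing w.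
split; [|split; [|split; [|split]]].
- move=> w Iw; rewrite (O_dual_conj e_basis pairing sI Iw); split=> //.
  by have [v vP] := ex w Iw; exists (flag sigma v); exists v.
- move=> w Iw; rewrite /OO_perp /OO_gamma /sigma_perp (iota_starE e_basis pairing).
  split.
  + exact: (relative_position_flags e_basis pairing sI
      (sI : injective (sigma : nat -> A^d)) (fun w v (h : dual_basis e Om w v) =>
      proj1 h) (dual_reduction e_basis pairing sI)
      (@flag_perpE _ _ _ e_basis _ _ _ pairing _ _ sigma) Iw).
  exact: (relative_position_flags e_basis pairing sI sI
    (fun w v (h : conjugate_basis e Om w v) => proj1 h)
    (conjugate_reduction e_basis pairing sI)
    (@flag_gammaE _ _ _ e_basis _ _ _ pairing _ _ sigma) Iw).
- rewrite (XE e_basis); apply/seteqP; split=> [_ [w Iw <-]|_ [_ [v Ev <-] <-]].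
    have [v [dv _]] := ex w Iw; exists (flag sigma v).
      by exists v => //; case: dv.
    by rewrite (O_dual_orbit e_basis pairing sigma Iw dv).
  have [w [v' [Iw dv' <-]]] := dual_reduction e_basis pairing sI Ev.
  by exists w => //; rewrite (O_dual_orbit e_basis pairing sigma Iw dv').
- rewrite (XE e_basis); apply/seteqP; split=> [_ [w Iw <-]|_ [_ [v Ev <-] <-]].
    have [v [_ cv]] := ex w Iw; exists (flag sigma v).
      by exists v => //; case: cv.
    by rewrite (O_conj_orbit e_basis pairing sigma Iw cv).
  have [w [v' [Iw cv' <-]]] := conjugate_reduction e_basis pairing sI Ev.
  by exists w => //; rewrite (O_conj_orbit e_basis pairing sigma Iw cv').
- move=> w Iw; have [v vP] := ex w Iw; exists (flag sigma v).
    by rewrite (XE e_basis); exists v => //; case: vP => -[].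
  rewrite (O_dual_conj e_basis pairing sI Iw).
  apply: (@orbit_of_good _ _ e _ _ _ _ (fun v => dual_basis e Om w v /\
    conjugate_basis e Om w v)) vP => //.
  + by move=> g [[]].
  + by move=> u [[]].
  + move=> g u [Kg Gg] [du cu].
    by split; [exact: dual_stable|exact: conjugate_stable].
  + by move=> u u'; exact: (KG0_transitive e_basis pairing).
Qed.
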